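(* Let $d\le 3$ and $\mu\in M_F(\mathbb{R}^d)$, let $X$ be the superprocess in a random environment with covariance function $g$ and $X_0=\mu$, and let $Y_t(\cdot)=\int_0^tX_s(\cdot)\,ds$. When $d=2$ or $3$, suppose that $x\mapsto\mu g_d(x)$ is continuous on $\mathbb{R}^d$. Then with $\mathbb{P}_\mu$-probability one, $Y_t(dx)$ is absolutely continuous with respect to Lebesgue measure $dx$ for all $t\ge 0$.
   Context: $M_F(\mathbb{R}^d)$ is the space of finite (Borel) measures on $\mathbb{R}^d$ with the topology of weak convergence, and $\nu(f)=\langle\nu,f\rangle=\int f\,d\nu$. $C_b^2(\mathbb{R}^d)$ is the space of bounded continuous functions with bounded continuous derivatives up to order 2. Fix a function $g:\mathbb{R}^d\times\mathbb{R}^d\to\mathbb{R}$ with $\|g\|_\infty=\sup_{x,y}|g(x,y)|<\infty$, which is the spatial covariance of a Gaussian noise $W$ white in time: $\mathbb{E}[W(t,x)W(s,y)]=g(x,y)(s\wedge t)$. The superprocess in a random environment with covariance function $g$ is an $M_F(\mathbb{R}^d)$-valued process $X=(X_t)_{t\ge0}$ on a complete filtered probability space $(\Omega,\mathcal{F},\mathcal{F}_t,\mathbb{P})$ such that for every $\phi\in C_b^2(\mathbb{R}^d)$, $$M_t(\phi)=X_t(\phi)-X_0(\phi)-\int_0^t X_s\big(\tfrac{\Delta}{2}\phi\big)\,ds$$ is a continuous $(\mathcal{F}_t)$-martingale with quadratic variation $$\langle M(\phi)\rangle_t=\int_0^t X_s(\phi^2)\,ds+\int_0^t ds\int_{\mathbb{R}^d}\int_{\mathbb{R}^d}g(u,v)\phi(u)\phi(v)\,X_s(du)X_s(dv).$$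 It is known (Mytnik) that the solution of this martingale problem is unique in law; $\mathbb{P}_\mu$, $\mathbb{E}_\mu$ denote the law and expectation when $X_0=\mu$. For $x\in\mathbb{R}^d$: $g_2(x)=\log^+(1/|x|)$ if $d=2$, $g_3(x)=|x|^{-1}$ if $d=3$; and $\mu g_d(x)=\int_{\mathbb{R}^d}g_d(x-y)\,\mu(dy)$ (its continuity includes that it is finite everywhere). *)

(* Defs.v *)
From HB Require Import structures.
From mathcomp Require Import all_boot all_order all_algebra.
From mathcomp Require Import all_classical all_reals all_analysis.
From mathcomp Require Import measurable_realfun.

Set Implicit Arguments.
Unset Strict Implicit.
Unset Printing Implicit Defensive.

Import Order.TTheory GRing.Theory Num.Theory.
Import numFieldNormedType.Exports.

Local Open Scope classical_set_scope.
Local Open Scope ring_scope.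

HB.instance Definition _ (R : realType) (m n : nat) :=
  @isMeasurable.Build (sigma_display (@open 'M[R]_(m, n))) 'M[R]_(m, n)
    <<s @open 'M[R]_(m, n) >>
    (@sigma_algebra0 _ setT (@open 'M[R]_(m, n)))
    (@sigma_algebraC _ (@open 'M[R]_(m, n)))
    (@sigma_algebra_bigcup _ setT (@open 'M[R]_(m, n))).

Section euclidean.
Context {R : realType}.

(* The [d]-fold product of the Lebesgue measure of [R], transported along
   R * 'rV_n -> 'rV_(1 + n). *)
Fixpoint lebesgue_rV (d : nat) : set 'rV[R]_d -> \bar R :=
  match d with
  | 0 => \d_(0 : 'rV[R]_0)
  | n.+1 => pushforward (@lebesgue_measure R \x @lebesgue_rV n)%E
      (fun p : R * 'rV[R]_n => row_mx p.1%:M p.2 : 'rV[R]_n.+1)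
  end.

(* The norm [`|x|] of ['rV_d] in the library is the sup norm. *)
Definition euclid_norm (d : nat) (x : 'rV[R]_d) : R :=
  Num.sqrt (\sum_(i < d) x ord0 i ^+ 2).

(* Extended-real operations, so that the value at the origin is [+oo]
   (0^-1 = +oo and lne +oo = +oo). *)
Definition green (d : nat) (x : 'rV[R]_d) : \bar R :=
  match d with
  | 2 => maxe 0 (lne ((euclid_norm x)%:E^-1))
  | 3 => (euclid_norm x)%:E^-1
  | _ => 0
  end%E.

Definition green_potential (d : nat) (mu : set 'rV[R]_d -> \bar R)
    (x : 'rV[R]_d) : \bar R :=
  (\int[mu]_y green (x - y))%E.

Definition continuous_finite (d : nat) (h : 'rV[R]_d -> \bar R) : Prop :=
  (forall x, h x \is a fin_num) /\ continuous (fine \o h).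

Definition Cb (d : nat) (f : 'rV[R]_d -> R) : Prop :=
  continuous f /\ bounded_fun f.

Definition partial (d : nat) (i : 'I_d) (f : 'rV[R]_d -> R) : 'rV[R]_d -> R :=
  fun x => 'D_(delta_mx ord0 i) f x.

Definition has_partial (d : nat) (i : 'I_d) (f : 'rV[R]_d -> R) : Prop :=
  forall x, derivable f x (delta_mx ord0 i).

Definition Cb2 (d : nat) (f : 'rV[R]_d -> R) : Prop :=
  [/\ Cb f,
      forall i, has_partial i f /\ Cb (partial i f) &
      forall i j, has_partial j (partial i f) /\ Cb (partial j (partial i f))].

Definition laplacian (d : nat) (f : 'rV[R]_d -> R) : 'rV[R]_d -> R :=
  fun x => \sum_(i < d) partial i (partial i f) x.

End euclidean.

Definition MF (R : realType) (d : nat) : Type :=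
  {finite_measure set 'rV[R]_d -> \bar R}.

Section weak_convergence.
Context {R : realType} {d : nat}.

Definition pairing (nu : MF R d) (f : 'rV[R]_d -> R) : R :=
  \int[nu]_x f x.

(* The sets { nu' | forall i < k, |nu'(f_i) - nu(f_i)| < e } form a basis of
   neighbourhoods of nu for the topology of weak convergence. *)
Definition weakly_open (U : set (MF R d)) : Prop :=
  forall nu, U nu ->
    exists (k : nat) (f : 'I_k -> 'rV[R]_d -> R) (e : R),
      [/\ forall i, Cb (f i), 0 < e &
          forall nu' : MF R d,
            (forall i, `|pairing nu' (f i) - pairing nu (f i)| < e) -> U nu'].

End weak_convergence.

Section martingales.
Context {d : measure_display} {Omega : measurableType d} {R : realType}.
Variables (P : probability Omega R) (F : R -> set (set Omega)).

Record complete_filtration : Prop := {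
  filtration_complete_space : measure_is_complete P ;
  filtration_sigma_algebra : forall t, 0 <= t -> sigma_algebra setT (F t) ;
  filtration_measurable : forall t, 0 <= t -> F t `<=` measurable ;
  filtration_le : forall s t, 0 <= s -> s <= t -> F s `<=` F t ;
  filtration_negligible : P.-negligible `<=` F 0 }.

Definition adapted (M : R -> Omega -> R) : Prop :=
  forall t, 0 <= t -> forall B : set R, measurable B -> F t (M t @^-1` B).

(* The last clause is E[M_t | F_s] = M_s, by the defining property of the
   conditional expectation. *)
Definition martingale (M : R -> Omega -> R) : Prop :=
  [/\ adapted M,
      forall t, 0 <= t -> P.-integrable setT (EFin \o M t) &
      forall s t, 0 <= s -> s <= t -> forall A, F s A ->
        (\int[P]_(w in A) (M t w)%:E = \int[P]_(w in A) (M s w)%:E)%E].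

Definition continuous_paths (M : R -> Omega -> R) : Prop :=
  {ae P, forall w, {within `[0, +oo[, continuous (M ^~ w)}}.

Definition stopping_time (tau : Omega -> \bar R) : Prop :=
  (forall w, 0 <= tau w)%E /\
  forall t, 0 <= t -> F t [set w | (tau w <= t%:E)%E].

Definition stopped (M : R -> Omega -> R) (tau : Omega -> \bar R) :
    R -> Omega -> R :=
  fun t w => M (fine (mine t%:E (tau w))) w.

Definition local_martingale (M : R -> Omega -> R) : Prop :=
  adapted M /\
  exists tau : nat -> Omega -> \bar R,
    [/\ forall n, stopping_time (tau n),
        {ae P, forall w, {homo tau ^~ w : m n / (m <= n)%N >-> (m <= n)%E}
                         /\ tau n w @[n --> \oo] --> +oo%E} &
        forall n, martingale (stopped (fun t w => M t w - M 0 w) (tau n))].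

(* <M> = A, as the increasing process of the Doob-Meyer decomposition. *)
Definition quadratic_variation (M A : R -> Omega -> R) : Prop :=
  [/\ adapted A,
      continuous_paths A,
      {ae P, forall w, A 0 w = 0
        /\ forall s t, 0 <= s -> s <= t -> A s w <= A t w} &
      local_martingale (fun t w => M t w ^+ 2 - A t w)].

End martingales.

(* [normal_prob m s] is a Gaussian law only for [s != 0], so the degenerate
   case is listed separately. *)
Definition gaussian_rv (d : measure_display) (Omega : measurableType d)
    (R : realType) (P : probability Omega R) (Z : Omega -> R) : Prop :=
  measurable_fun setT Z /\
  exists m : R,
    {ae P, forall w, Z w = m} \/
    exists2 s : R, 0 < s &
      forall B : set R, measurable B -> P (Z @^-1` B) = normal_prob m s B.

Definition gaussian_noise (R : realType) (n : nat)
    (g : 'rV[R]_n -> 'rV[R]_n -> R) (d : measure_display)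
    (Omega : measurableType d) (P : probability Omega R)
    (W : R -> 'rV[R]_n -> Omega -> R) : Prop :=
  [/\ forall (k : nat) (a t : 'I_k -> R) (x : 'I_k -> 'rV[R]_n),
        (forall i, 0 <= t i) ->
        gaussian_rv P (fun w => \sum_(i < k) a i * W (t i) (x i) w),
      forall t x, 0 <= t -> ('E_P[W t x] = 0)%E &
      forall s t x y, 0 <= s -> 0 <= t ->
        ('E_P[fun w => W t x w * W s y w]%R = (g x y * Num.min s t)%:E)%E].

Definition noise_covariance (R : realType) (n : nat)
    (g : 'rV[R]_n -> 'rV[R]_n -> R) : Prop :=
  exists (d : measure_display) (Omega : measurableType d)
    (P : probability Omega R) (W : R -> 'rV[R]_n -> Omega -> R),
    gaussian_noise g P W.

(* Measurability is what gives a meaning to the double integrals of [g]. *)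
Record bounded_covariance (R : realType) (n : nat)
    (g : 'rV[R]_n -> 'rV[R]_n -> R) : Prop := {
  covariance_noise : noise_covariance g ;
  covariance_bounded : exists C : R, forall x y, `|g x y| <= C ;
  covariance_measurable :
    measurable_fun setT (fun p : 'rV[R]_n * 'rV[R]_n => g p.1 p.2) }.

Section superprocess.
Context {R : realType} {n : nat} {d : measure_display}
  {Omega : measurableType d}.
Variables (g : 'rV[R]_n -> 'rV[R]_n -> R) (P : probability Omega R)
  (F : R -> set (set Omega)) (X : R -> Omega -> MF R n).

Definition mp_martingale (phi : 'rV[R]_n -> R) : R -> Omega -> R :=
  fun t w => pairing (X t w) phi - pairing (X 0 w) phi
    - \int[lebesgue_measure]_(s in `[0, t])
        pairing (X s w) (fun x => laplacian phi x / 2).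

Definition mp_bracket (phi : 'rV[R]_n -> R) : R -> Omega -> R :=
  fun t w =>
    \int[lebesgue_measure]_(s in `[0, t]) pairing (X s w) (fun x => phi x ^+ 2)
    + \int[lebesgue_measure]_(s in `[0, t])
        pairing (X s w) (fun u =>
          pairing (X s w) (fun v => g u v * phi u * phi v)).

(* [superprocess_path_measurable] is what gives a meaning to the time
   integrals; it holds in particular if the paths are weakly continuous. *)
Record superprocess : Prop := {
  superprocess_filtration : complete_filtration P F ;
  superprocess_adapted : forall t, 0 <= t ->
    forall U, weakly_open U -> F t (X t @^-1` U) ;
  superprocess_path_measurable : {ae P, forall w,
    forall B : set 'rV[R]_n, measurable B ->
      measurable_fun (`[0, +oo[ : set R) (fun s => (X s w B : \bar R))} ;
  superprocess_martingale : forall phi, Cb2 phi ->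
    martingale P F (mp_martingale phi)
    /\ continuous_paths P (mp_martingale phi) ;
  superprocess_bracket : forall phi, Cb2 phi ->
    quadratic_variation P F (mp_martingale phi) (mp_bracket phi) }.

Definition starts_at (mu : MF R n) : Prop :=
  {ae P, forall w, forall B, measurable B -> X 0 w B = mu B}.

Definition occupation (t : R) (w : Omega) (B : set 'rV[R]_n) : \bar R :=
  (\int[lebesgue_measure]_(s in `[0%R, t]) X s w B)%E.

End superprocess.

(* Main.v *)
From HB Require Import structures.
Require Import Defs.
From mathcomp Require Import all_boot all_order all_algebra.
From mathcomp Require Import all_classical all_reals all_analysis.
From mathcomp Require Import measurable_realfun.
From mathcomp Require Import ring lra zify.

(* Test the martingale problem with the waves e(x) = cos (2 pi k.x + a). They
   are eigenfunctions of the Laplacian, so that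
     2 pi^2 |k|^2 Y_T(e) = X_0(e) - X_T(e) + M_T(e),
   and the bracket A of M(e) is bounded uniformly in k. Since
   E[M_T^2; A_T <= a] <= 2 a + 1 (a form of Lenglart's inequality), the Fourier
   coefficients of Y_T satisfy |Y_T^(k)|^2 = O(|k|^-4) in mean, after
   localisation. As sum |k|^-4 < oo for n <= 3, Fatou's lemma bounds, along a
   random subsequence of M, the means
     M^-n sum_{J, J' in [0, M)^n} |Y_T^(J - J')|^2.
   Finally the kernels |sum_J exp (2 pi i J.(x - q))|^2 dominate M^2n / 2 on the
   cubes of side 1 / (24 M) with corner q; summing over a union U of such cubes
   and using discrete orthogonality and the arithmetic-geometric inequality gives
     Y_T(U) <= sigma C + (C' / sigma) |U|   for every sigma > 0,
   which implies absolute continuity. *)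

Set Implicit Arguments.
Unset Strict Implicit.
Unset Printing Implicit Defensive.

Import Order.TTheory GRing.Theory Num.Theory.
Import numFieldNormedType.Exports.

Local Open Scope classical_set_scope.
Local Open Scope ring_scope.

(** The obstacle is integrability. The bracket [A] is quadratic in the total mass, no second moment
    of which is at hand, and [M^2 - A] is only a local martingale; hence second moments are taken on
    [{A_T <= a}] only. The passage of [A] above [a] is observed along finite time grids, so that the
    martingale property is used at deterministic times and no optional stopping in continuous time
    is involved. For a single path the mass is bounded on [[0, T]], and this bounds the brackets of
    all waves at once: one level [a] serves every frequency, and integer levels suffice, which costs
    only countably many null sets. Integer frequencies see only the image of [Y_T] on the torus
    [R^n / Z^n]. This is enough because [Y_T] is nonnegative: the same bound holds in every unit
    cell. The double mean over [J, J'] puts the Fejer weights [prod_i (1 - |k_i| / M)^+] on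
    [|Y_T^(k)|^2]; it comes with the squared kernels, whose nonnegativity allows them to be bounded
    below on small cubes, so that no density has to be constructed. *)

Lemma sigma_algebra_setI (T : Type) (G : set (set T)) :
  sigma_algebra setT G -> setI_closed G.
Proof.
move=> [G0 GC GU] A B GA GB.
rewrite -(setCK (A `&` B)) setCI -!setTD; apply: (GC); rewrite -bigcup2E.
apply: GU => -[|[|i]] //=; exact: (GC).
Qed.

Lemma integral_ge_cst (d : measure_display) (T : measurableType d)
    (R : realType) (P : {finite_measure set T -> \bar R}) (D : set T)
    (f : T -> R) (c : R) :
  measurable D -> P.-integrable D (EFin \o f) ->
  {ae P, forall w, D w -> c <= f w} ->
  (c%:E * P D <= \int[P]_(w in D) (f w)%:E)%E.
Proof.
move=> mD fi cf.
have mf := measurable_int _ fi.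
have ci : P.-integrable D (cst c%:E).
  apply: finite_measure_integrable_cst => //.
have e : ae_eq P D (EFin \o f) (fun w => maxe (f w)%:E c%:E).
  apply: filterS cf => w h Dw /=.
  by rewrite -EFin_max max_l// h.
have mi : P.-integrable D (fun w => maxe (f w)%:E c%:E).
  apply: (le_integrable mD _ _ (integrableD mD (integrable_abse fi) (integrable_abse ci))) => //.
    by apply: measurable_maxe.
  move=> w _ /=; rewrite -EFin_max !lee_fin.
  rewrite [leRHS]ger0_norm ?addr_ge0//.
  by case: (leP (f w) c) => _; rewrite ?lerDl ?lerDr.
rewrite -(integral_cst P mD) (ae_eq_integral _ _ mD mf (measurable_int _ mi) e).
apply: le_integral => // w _.
by rewrite le_max lexx orbT.
Qed.

(** * Passage of an increasing process above a level, along time grids *)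

Section first_exit.
Context {d : measure_display} {Omega : measurableType d} {R : realType}.
Variables (P : probability Omega R) (F : R -> set (set Omega)).
Hypothesis cF : complete_filtration P F.
Implicit Types (A K : R -> Omega -> R) (T a : R).

Definition grid T m j : R := T * (j%:R / m.+1%:R).

Lemma grid_ge0 T m j : 0 <= T -> 0 <= grid T m j.
Proof. by move=> T0; rewrite mulr_ge0// divr_ge0. Qed.

Lemma grid_le T m j : 0 <= T -> (j <= m.+1)%N -> grid T m j <= T.
Proof.
move=> T0 jm; rewrite -[leRHS]mulr1 ler_wpM2l// ler_pdivrMr ?ltr0n//.
by rewrite mul1r ler_nat.
Qed.

Definition below_until A T a m j : set Omega :=
  [set w | forall i, (i < j)%N -> A (grid T m i) w <= a].

(** The bound [a + 1] discards the paths that overshoot the level. It gives [K >= - A >= - (a + 1)]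
    at the exit time, and by continuity of [A] it loses no given path once the mesh is fine. *)
Definition first_exit A T a m j : set Omega :=
  below_until A T a m j `&` [set w | a < A (grid T m j) w <= a + 1].

Lemma adapted_measurable_fun A t : adapted F A -> 0 <= t ->
  measurable_fun setT (A t).
Proof.
move=> aA t0 _ B mB; rewrite setTI.
exact: (filtration_measurable cF t0 (aA t t0 B mB)).
Qed.

Lemma below_until_adapted A T a m j : adapted F A -> 0 <= T ->
  F (grid T m j) (below_until A T a m j).
Proof.
move=> aA T0; elim: j => [|j IH].
  have -> : below_until A T a m 0 = setT by apply/seteqP; split.
  have [F0 FC _] := filtration_sigma_algebra cF (grid_ge0 m 0 T0).
  by rewrite -(setD0 setT); exact: FC.
have -> : below_until A T a m j.+1 =
    below_until A T a m j `&` (A (grid T m j) @^-1` `]-oo, a]).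
  apply/seteqP; split => [w h|w [h1 h2] i].
    by split => [i ij|]; [apply: h; exact: ltnW|rewrite /= in_itv/=; exact: h].
  rewrite ltnS leq_eqVlt => /orP[/eqP ->|]; last exact: h1.
  by move: h2; rewrite /= in_itv.
have le : grid T m j <= grid T m j.+1.
  by rewrite ler_wpM2l// ler_pM2r ?invr_gt0 ?ltr0n// ler_nat.
apply: (filtration_le cF _ le); first exact: grid_ge0.
apply: sigma_algebra_setI => //; first exact/(filtration_sigma_algebra cF)/grid_ge0.
by apply: aA => //; exact: grid_ge0.
Qed.

Lemma first_exit_adapted A T a m j : adapted F A -> 0 <= T ->
  F (grid T m j) (first_exit A T a m j).
Proof.
move=> aA T0; apply: sigma_algebra_setI.
- exact/(filtration_sigma_algebra cF)/grid_ge0.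
- exact: below_until_adapted.
- have -> : [set w | a < A (grid T m j) w <= a + 1] =
    A (grid T m j) @^-1` `]a, a + 1].
    by apply/seteqP; split => w /=; rewrite in_itv.
  by apply: aA => //; exact: grid_ge0.
Qed.

Lemma measurable_first_exit A T a m j : adapted F A -> 0 <= T ->
  measurable (first_exit A T a m j).
Proof.
move=> aA T0; apply: (filtration_measurable cF (grid_ge0 m j T0)).
exact: first_exit_adapted.
Qed.

Lemma trivIset_first_exit A T a m D : trivIset D (first_exit A T a m).
Proof.
move=> i j _ _ [w [[bi /andP[ai _]] [bj /andP[aj _]]]].
case: (ltngtP i j) => // ij.
- by move: (bj _ ij); rewrite leNgt ai.
- by move: (bi _ ij); rewrite leNgt aj.
Qed.

Definition exited A T a m : set Omega :=
  \big[setU/set0]_(j <- iota 0 m.+2) first_exit A T a m j.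

Lemma measurable_exited A T a m : adapted F A -> 0 <= T ->
  measurable (exited A T a m).
Proof.
by move=> aA T0; apply: bigsetU_measurable => j _; exact: measurable_first_exit.
Qed.

(** Optional stopping by hand: the events [first_exit A T a m j] are disjoint and known at time
    [grid T m j], so on each of them [K T] may be replaced by [K] at the exit time, where it is at
    least [- (a + 1)]. *)
Lemma martingale_exited_ge A K T a m : martingale P F K -> adapted F A ->
  0 <= T -> 0 <= a ->
  {ae P, forall w, forall t, 0 <= t -> - A t w <= K t w} ->
  (- (a + 1)%:E <= \int[P]_(w in exited A T a m) (K T w)%:E)%E.
Proof.
move=> [aK iK mgK] aA T0 a0 lb.
have mD j := measurable_first_exit a m j aA T0.
have mE : measurable (exited A T a m) by exact: measurable_exited.
have mf f : measurable_fun setT f -> (\int[P]_(w in exited A T a m) (f w)%:E =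
    \sum_(j <- iota 0 m.+2) \int[P]_(w in first_exit A T a m j) (f w)%:E)%E.
  move=> mf; rewrite /exited integral_bigsetU_EFin//.
  - exact: iota_uniq.
  - exact: trivIset_first_exit.
  - by apply: (measurable_funS measurableT) => //; exact/measurable_EFinP.
apply: (@le_trans _ _ (\int[P]_(w in exited A T a m) (- (a + 1))%:E)%E).
  rewrite (integral_cst P mE (- (a + 1))%:E) EFinN mulNe leeN2 -[leRHS]mule1.
  by rewrite lee_pmul2l// ?probability_le1// lte_fin ltr_wpDl.
rewrite mf// mf; last exact/measurable_EFinP/(measurable_int _ (iK _ T0)).
rewrite big_seq [leRHS]big_seq; apply: lee_sum => j.
rewrite mem_iota add0n ltnS => /andP[_ jm].
rewrite (mgK _ _ (grid_ge0 m j T0) (grid_le T0 jm)); last exact: first_exit_adapted.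
rewrite (integral_cst P (mD j)); apply: integral_ge_cst => //.
  by apply: (integrableS measurableT) => //; apply: iK; exact: grid_ge0.
apply: filterS lb => w lb [_ /andP[_ h]].
by rewrite (le_trans _ (lb _ (grid_ge0 m j T0)))// lerN2.
Qed.

Lemma exitedP A T a m w :
  exited A T a m w <-> exists2 j, (j <= m.+1)%N & first_exit A T a m j w.
Proof.
rewrite /exited -bigcup_seq; split => [[j jm]|[j jm]] wj; exists j => //.
  by move: (jm : j \in iota 0 m.+2); rewrite mem_iota.
by change (j \in iota 0 m.+2); rewrite mem_iota.
Qed.

(** If [a < A T w], let [s] be the supremum of the times at which [A <= a]. When the mesh is fine,
    [A] differs from [A s w] by less than 1/2 at both grid points around [s]; the step that leaves
    []-oo, a]] is therefore shorter than 1 and ends below [a + 1]. *)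
Lemma exited_eventually A T a w : 0 <= T ->
  {within `[0, +oo[, continuous (A ^~ w)} ->
  (forall s t, 0 <= s -> s <= t -> A s w <= A t w) -> A 0 w <= a ->
  \forall m \near \oo, (w \in exited A T a m) = (a < A T w).
Proof.
move=> T0 cA hA A0; have [AT|aA] := leP (A T w) a.
  near=> m; apply/negbTE/negP; rewrite inE => /exitedP[j jm [_ /andP[]]].
  rewrite ltNge => /negP + _; apply; apply: le_trans AT.
  by apply: hA; [exact: grid_ge0|exact: grid_le].
pose S := [set r | 0 <= r <= T /\ A r w <= a]; pose s := sup S.
have S0 : S 0 by split; rewrite ?lexx.
have uS : has_sup S.
  by split; [exists 0|exists T => r [/andP[]]].
have s0 : 0 <= s by exact: sup_upper_bound.
have sle t : 0 <= t <= T -> A t w <= a -> t <= s.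
  by move=> t0 ta; apply: sup_upper_bound.
have les t : 0 <= t -> a < A t w -> s <= t.
  move=> t0 ta; apply: ge_sup => [|r [/andP[r0 _] ra]]; first by exists 0.
  rewrite leNgt; apply/negP => tr.
  by have := hA _ _ t0 (ltW tr); rewrite leNgt (le_lt_trans ra ta).
have /subspace_continuousP/(_ s) := cA.
rewrite /= in_itv/= andbT => /(_ s0)/cvgrPdist_lt/(_ (2^-1)).
rewrite invr_gt0 ltr0n => /(_ isT); rewrite near_withinE => /nbhs_ballP[e /= e0 he].
have close t : 0 <= t -> `|s - t| < e -> `|A s w - A t w| < 2^-1.
  by move=> t0 te; apply: (he t) => //=; rewrite in_itv/= t0.
have : \forall m \near \oo, T / m.+1%:R < e.
  near=> m; rewrite ltr_pdivrMr ?ltr0n// mulrC -ltr_pdivrMr//.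
  apply: lt_le_trans (_ : m%:R <= _); last by rewrite ler_nat.
  by near: m; exact: nbhs_infty_gtr.
move=> hm; near=> m.
have me : T / m.+1%:R < e by near: m.
have exj : exists j, a < A (grid T m j) w.
  by exists m.+1; rewrite /grid divff ?mulr1// pnatr_eq0.
pose j := ex_minn exj.
have [ja jmin] : a < A (grid T m j) w /\
    forall i, a < A (grid T m i) w -> (j <= i)%N by rewrite /j; case: ex_minnP.
have jm : (j <= m.+1)%N.
  by apply: jmin; rewrite /grid divff ?mulr1// pnatr_eq0.
apply/mem_set/exitedP; exists j => //.
have blw i : (i < j)%N -> A (grid T m i) w <= a.
  by move=> ij; rewrite leNgt; apply/negP => /jmin; rewrite leqNgt ij.
split; first exact: blw.
rewrite /= ja /=; case: (j) ja jm blw => [|i] ja jm blw.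
  by move: ja; rewrite /grid mul0r mulr0 ltNge A0.
have ti : grid T m i <= s.
  by apply: sle (blw _ _) => //; rewrite grid_ge0// grid_le// ltnW.
have tj : s <= grid T m i.+1 by apply: les => //; exact: grid_ge0.
have tij : grid T m i.+1 = grid T m i + T / m.+1%:R.
  by rewrite /grid -natr1 mulrDl mulrDr mul1r.
move: me tij; set q := T / _ => me tij.
have h1 : `|A s w - A (grid T m i) w| < 2^-1.
  by apply: close; rewrite ?grid_ge0// ger0_norm ?subr_ge0//; move: me tij ti tj; lra.
have h2 : `|A s w - A (grid T m i.+1) w| < 2^-1.
  by apply: close; rewrite ?grid_ge0// ler0_norm ?subr_le0//; lra.
have h3 := blw i (ltnSn i).
move: h1 h2; rewrite !ltr_norml => /andP[h11 h12] /andP[h21 h22]; lra.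
Unshelve. all: by end_near.
Qed.

(** As [K T] has mean zero, it suffices to bound its integral from below on [{a < A T}]. The
    indicators of the [exited] events converge to that of this set, and [|K T|] dominates. *)
Lemma martingale_sublevel_le A K T a : martingale P F K -> adapted F A ->
  continuous_paths P A ->
  {ae P, forall w, A 0 w = 0
    /\ forall s t, 0 <= s -> s <= t -> A s w <= A t w} ->
  {ae P, forall w, forall t, 0 <= t -> - A t w <= K t w} ->
  (forall w, K 0 w = 0) -> 0 <= T -> 0 <= a ->
  (\int[P]_(w in [set w | (A T w <= a)%R]) (K T w)%:E <= (a + 1)%:E)%E.
Proof.
move=> mK aA cA incA lb K0 T0 a0.
have [aK iK mgK] := mK.
have mKT : measurable_fun setT (EFin \o K T) := measurable_int _ (iK _ T0).
have mAT : measurable_fun setT (A T) := adapted_measurable_fun aA T0.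
pose B := [set w | a < A T w].
have mB : measurable B.
  have -> : B = A T @^-1` `]a, +oo[ by apply/seteqP; split => w /=; rewrite in_itv/= andbT.
  by rewrite -[_ @^-1` _]setTI; exact: mAT.
have BC : [set w | A T w <= a] = ~` B.
  by apply/seteqP; split => w /=; rewrite leNgt => /negP.
have mE m : measurable (exited A T a m) by exact: measurable_exited.
have dc := @dominated_convergence _ _ _ P setT measurableT
  (fun m => (EFin \o K T) \_ (exited A T a m)) ((EFin \o K T) \_ B)
  (abse \o (EFin \o K T)).
have cvE : (\int[P]_(w in exited A T a m) (K T w)%:E)%E @[m --> \oo] -->
    (\int[P]_(w in B) (K T w)%:E)%E.
  rewrite [X in _ --> X]integral_mkcond.
  rewrite (_ : (fun m => _) = fun m => (\int[P]_w ((EFin \o K T) \_ (exited A T a m)) w)%E); last first.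
    by apply/funext => m; rewrite integral_mkcond.
  case: dc; last by [].
  - move=> m; apply/(measurable_restrictT _ (mE m)).
    exact: (measurable_funS measurableT).
  - by apply/(measurable_restrictT _ mB); exact: (measurable_funS measurableT).
  - apply: filterS2 cA incA => w cw [A0 iw] _.
    have Aa : A 0 w <= a by rewrite A0.
    have h := exited_eventually T0 cw iw Aa.
    apply: cvg_near_cst; near=> m.
    have -> : ((EFin \o K T) \_ B) w = if a < A T w then (K T w)%:E else 0%E.
      by rewrite /patch /B mem_setE.
    by rewrite /patch (near h m)//; near: m.
  - exact/integrable_abse/iK.
  - apply: aeW => w m _; rewrite /patch; case: ifP => _ //=.
    by rewrite normr0 lee_fin.
have le1 : (- (a + 1)%:E <= \int[P]_(w in B) (K T w)%:E)%E.
  rewrite -(cvg_lim _ cvE)//; apply: lime_ge; first by apply: cvgP cvE.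
  by near=> m; exact: martingale_exited_ge.
have tot : (\int[P]_w (K T w)%:E = 0)%E.
  have FT : F 0 setT.
    have [F0 FC _] := filtration_sigma_algebra cF (lexx 0).
    by rewrite -(setD0 setT); exact: FC.
  rewrite (mgK _ _ (lexx 0) T0 _ FT).
  by under eq_integral do rewrite K0; rewrite integral0.
have fB : (\int[P]_(w in B) (K T w)%:E)%E \is a fin_num.
  by apply: integrable_fin_num => //; apply: (integrableS measurableT) => //; exact: iK.
move: tot; rewrite -(setUv B) integral_setU_EFin//; last 3 first.
- exact: measurableC.
- by rewrite setUv; exact/measurable_EFinP.
- exact/disj_setPCl.
rewrite -BC; move: le1 fB; case: (\int[P]_(w in B) _)%E => [x| |]//.
case: (\int[P]_(w in _) _)%E => [y| |]//.
by rewrite -!EFinN -EFinD !lee_fin => ? _ [?]; lra.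
Unshelve. all: by end_near.
Qed.

End first_exit.

(** * Lower limits and Fatou's lemma *)

Section limn_einf.
Context {R : realType}.
Local Open Scope ereal_scope.
Implicit Types (u : (\bar R)^nat) (c : \bar R).

Lemma le_limn_einf u c : (\forall n \near \oo, c <= u n) -> c <= limn_einf u.
Proof.
move=> cu; rewrite limn_einf_lim; apply: lime_ge; first exact: is_cvg_einfs.
have [N _ hN] := cu; near=> n; apply: le_ereal_inf_tmp => _ [m /= nm <-].
by apply: hN => /=; apply: leq_trans nm; near: n; exact: nbhs_infty_ge.
Unshelve. all: by end_near. Qed.

Lemma limn_einf_le u c : (forall n, u n <= c) -> limn_einf u <= c.
Proof.
move=> uc; rewrite limn_einf_lim; apply: lime_le; first exact: is_cvg_einfs.
apply: nearW => n; apply: le_trans (uc n); apply: ereal_inf_lbound.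
by exists n => /=.
Qed.

Lemma limn_einf_lt_frequently u (c : \bar R) : limn_einf u < c ->
  forall N, exists2 n, (N <= n)%N & u n < c.
Proof.
move=> uc N; apply: contrapT => h; move: uc; rewrite ltNge => /negP; apply.
apply: le_limn_einf; exists N => // n /= Nn; rewrite leNgt; apply/negP => un.
by apply: h; exists n.
Qed.

End limn_einf.

Lemma measurable_fun_limn_einf (d : measure_display) (T : measurableType d)
    (R : realType) (D : set T) (f : (T -> \bar R)^nat) :
  (forall n, measurable_fun D (f n)) ->
  measurable_fun D (fun x => limn_einf (f ^~ x)).
Proof.
move=> mf mD; rewrite /limn_einf; apply: measurableT_comp => //.
by apply: measurable_fun_limn_esup => n; exact: measurableT_comp.
Qed.

Lemma ae_le_integral_fatou (d : measure_display) (T : measurableType d)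
    (R : realType) (P : {measure set T -> \bar R}) (D : set T)
    (f : (T -> \bar R)^nat) (g : T -> \bar R) (c : \bar R) :
  measurable D -> (forall n, measurable_fun D (f n)) ->
  (forall n x, D x -> (0 <= f n x)%E) -> measurable_fun D g ->
  (forall x, D x -> (0 <= g x)%E) ->
  {ae P, forall x, D x -> \forall n \near \oo, (g x <= f n x)%E} ->
  (forall n, (\int[P]_(x in D) f n x <= c)%E) ->
  (\int[P]_(x in D) g x <= c)%E.
Proof.
move=> mD mf f0 mg g0 gf fc.
apply: le_trans (limn_einf_le fc); apply: le_trans (fatou P mD mf f0).
apply: ae_ge0_le_integral => //.
- by move=> x Dx; apply: le_limn_einf; apply: nearW => n; exact: f0.
- exact: measurable_fun_limn_einf.
- by apply: filterS gf => x h Dx; apply: le_limn_einf; exact: h.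
Qed.

(** * Second moment of a martingale where its bracket is small *)

Section quadratic_variation_sublevel.
Context {d : measure_display} {Omega : measurableType d} {R : realType}.
Variables (P : probability Omega R) (F : R -> set (set Omega)).
Hypothesis cF : complete_filtration P F.

Let fine_min (t : R) (tau : \bar R) : (0 <= tau)%E -> 0 <= t ->
  0 <= fine (mine t%:E tau) <= t.
Proof.
case: tau => [r| |]//; rewrite ?lee_fin => r0 t0.
  by rewrite -EFin_min /= le_min ge_min r0 t0 lexx.
by rewrite /mine ltry /= t0 lexx.
Qed.

(** The stopped process [K n] of [M^2 - A] satisfies [K n >= - A], because squares are nonnegative
    and [A] increases; so its integral over [{A T <= a}] is at most [a + 1]. Adding [a] makes the
    integrand nonnegative there, and Fatou's lemma removes the localisation. *)
Lemma quadratic_variation_sublevel (M A : R -> Omega -> R) (T a : R) :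
  adapted F M -> (forall w, M 0 w = 0) -> quadratic_variation P F M A ->
  0 <= T -> 0 <= a ->
  (\int[P]_(w in [set w | (A T w <= a)%R]) ((M T w) ^+ 2)%:E <=
     (2 * a + 1)%:E)%E.
Proof.
move=> aM M0 [aA cA iA [aN [tau [stau taucvg mN]]]] T0 a0.
pose N t w := M t w ^+ 2 - A t w.
pose K n := stopped (fun t w => N t w - N 0 w) (tau n).
have tau0 n w : (0 <= tau n w)%E by case: (stau n).
have K0 n w : K n 0 w = 0.
  rewrite /K /stopped.
  have /andP[h1 h2] := fine_min (tau0 n w) (lexx 0).
  by rewrite (le_anti (introT andP (conj h2 h1))) subrr.
have lb n : {ae P, forall w, forall t, 0 <= t -> - A t w <= K n t w}.
  apply: filterS iA => w [A0 iA] t t0; rewrite /K /stopped /N.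
  have /andP[h1 h2] := fine_min (tau0 n w) t0.
  have := iA _ _ h1 h2; have := sqr_ge0 (M (fine (mine t%:E (tau n w))) w).
  by rewrite M0 A0; lra.
have le n := martingale_sublevel_le cF (mN n) aA cA iA (lb n) (K0 n) T0 a0.
have mMT : measurable_fun setT (M T) := adapted_measurable_fun cF aM T0.
have mAT : measurable_fun setT (A T) := adapted_measurable_fun cF aA T0.
set B := [set w | A T w <= a] in le *.
have mB : measurable B.
  have -> : B = A T @^-1` `]-oo, a] by apply/seteqP; split => w /=; rewrite in_itv.
  by rewrite -[_ @^-1` _]setTI; exact: mAT.
have iK n : P.-integrable B (EFin \o K n T).
  by have [_ /(_ _ T0) + _] := mN n; apply: integrableS.
have mK n : measurable_fun B (K n T) by apply/measurable_EFinP/(measurable_int _ (iK n)).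
have ia : P.-integrable B (EFin \o cst a) by exact: finite_measure_integrable_cst.
(* The maximum provides nonnegativity everywhere; almost everywhere on [B] it equals
   [K n T w + a]. *)
apply: (ae_le_integral_fatou (f := fun n w => (Num.max 0 (K n T w + a))%:E)) => //.
- move=> n; apply/measurable_EFinP/measurable_maxr => //.
  exact: measurable_funD.
- by move=> n w _; rewrite lee_fin le_max lexx.
- apply/measurable_EFinP; apply: (measurable_funS measurableT) => //.
  exact: measurable_funX.
- by move=> w _; rewrite lee_fin sqr_ge0.
- apply: filterS2 iA taucvg => w [A0 iAw] [_ cw] Bw.
  have : \forall n \near \oo, (T%:E < tau n w)%E.
    by move/cvgeyPgt : cw => /(_ T).
  apply: filterS => n Tn; rewrite lee_fin le_max; apply/orP; right.
  rewrite /K /stopped /N min_l; last exact: ltW.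
  move: Bw; rewrite /B /= M0 A0; lra.
- move=> n; rewrite (ae_eq_integral (fun w => (K n T w)%:E + a%:E)%E) //.
  + rewrite integralD//; last exact: iK.
    rewrite (_ : 2 * a + 1 = (a + 1) + a); last by ring.
    rewrite EFinD leeD//; first exact: le.
    rewrite (integral_cst P mB) -[leRHS]mule1 lee_wpmul2l//.
    exact: probability_le1.
  + apply/measurable_EFinP/measurable_maxr => //; exact: measurable_funD.
  + by apply/measurable_EFinP; exact: measurable_funD.
  + apply: filterS (lb n) => w /(_ _ T0) h Bw; rewrite -EFinD max_r//.
    move: Bw h; rewrite /B /=; lra.
Qed.

End quadratic_variation_sublevel.

(** * Discrete Fourier analysis on a grid, in real form *)

Section trigonometric_sums.
Context {R : realType}.

(** Real form of the expansion of [|sum_i exp (i f_i)|^2]. *)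
Lemma sqr_sum_cos_sin (I : finType) (p : pred I) (f : I -> R) :
  (\sum_(i | p i) cos (f i)) ^+ 2 + (\sum_(i | p i) sin (f i)) ^+ 2 =
  \sum_(i | p i) \sum_(j | p j) cos (f i - f j).
Proof.
rewrite !expr2 !big_distrlr -big_split; apply: eq_bigr => i _.
by rewrite -big_split; apply: eq_bigr => j _; rewrite cosB.
Qed.

(* The sum is a combination of [cos c] and [sin c] which is invariant under
   [c -> c + theta]. *)
Lemma sum_cos_shift_eq0 (I : finType) (f : I -> R) (h : I -> I) (theta : R) :
  injective h -> (forall c i, cos (f (h i) + c) = cos (f i + theta + c)) ->
  cos theta != 1 -> \sum_i cos (f i) = 0.
Proof.
move=> hinj fh th1.
pose S c := \sum_i cos (f i + c).
have Sshift c : S c = S (theta + c).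
  rewrite /S (reindex_inj hinj); apply: eq_bigr => i _.
  by rewrite fh addrA.
have S0 c : S (theta + c) + S (- theta + c) = 2 * cos theta * S c.
  rewrite /S -big_split mulr_sumr; apply: eq_bigr => i _ /=.
  have -> : f i + (theta + c) = (f i + c) + theta by ring.
  have -> : f i + (- theta + c) = (f i + c) - theta by ring.
  by rewrite cosB cosD; ring.
have := S0 0; rewrite -Sshift (Sshift (- theta + 0)) addrA subrr add0r => S00.
have : (cos theta - 1) * S 0 = 0 by move: S00; lra.
move/eqP; rewrite mulf_eq0 subr_eq0 (negbTE th1)/= => /eqP S00'.
by rewrite -[RHS]S00'; apply: eq_bigr => i _; rewrite addr0.
Qed.

Lemma cos_periodz (x : R) (z : int) : cos (x + 2 * pi * z%:~R) = cos x.
Proof.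
have per n : cos (x + 2 * pi * n%:R) = cos x.
  by rewrite -[RHS](periodicn (@cosD2pi R) n) -[in RHS]mulr_natr -[pi *+ 2]mulr_natl.
case: z => n; first exact: per.
rewrite NegzE mulrNz mulrN -cosN opprB -[in RHS]cosN.
have -> : 2 * pi * n.+1%:~R - x = (- x) + 2 * pi * n.+1%:R by rewrite addrC.
by rewrite -[RHS](periodicn (@cosD2pi R) n.+1) -[in RHS]mulr_natr -[pi *+ 2]mulr_natl.
Qed.

Lemma cos_rational_neq1 (L : nat) (r : int) : (0 < L)%N -> (0 < `|r| < L)%N ->
  cos (2 * pi * (r%:~R / L%:R)) != 1 :> R.
Proof.
move=> L0 /andP[r0 rL].
rewrite -cos_norm !normrM (@ger0_norm _ 2)// (ger0_norm (pi_ge0 R)).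
rewrite normfV (@ger0_norm _ L%:R)// -intr_norm -natr_absz.
pose t : R := pi * (`|r|%N%:R / L%:R).
have -> : 2 * pi * (`|r|%N%:R / L%:R) = t *+ 2 :> R by rewrite /t -mulr_natr; ring.
rewrite cos_mulr2n cos2sin2.
have : 0 < sin t.
  apply: sin_gt0_pi; rewrite /t mulr_gt0 ?pi_gt0 ?divr_gt0 ?ltr0n//=.
  rewrite -[ltRHS]mulr1 ltr_pM2l ?pi_gt0// ltr_pdivrMr ?ltr0n// mul1r ltr_nat//.
move=> /(exprn_gt0 2) s0; apply/eqP; move: s0; lra.
Qed.

End trigonometric_sums.

Section phase.
Context {R : realType} {n : nat}.
Implicit Types (k : {ffun 'I_n -> int}) (x y : 'rV[R]_n).

Definition phase k x : R := 2 * pi * \sum_i (k i)%:~R * x ord0 i.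

Lemma phaseBr k x y : phase k (x - y) = phase k x - phase k y.
Proof.
rewrite /phase -mulrBr -sumrB; congr (_ * _); apply: eq_bigr => i _.
by rewrite !mxE mulrBr.
Qed.

Lemma phaseBl k k' x : phase (k - k') x = phase k x - phase k' x.
Proof.
rewrite /phase -mulrBr -sumrB; congr (_ * _); apply: eq_bigr => i _.
by rewrite !ffunE intrB mulrBl.
Qed.

Section grid_points.
Variables (L : nat) (z : {ffun 'I_n -> int}).
Implicit Types (J q : {ffun 'I_n -> 'I_L}).

Definition frequency J : {ffun 'I_n -> int} := [ffun i => (J i : nat)%:Z].

Definition grid_point q : 'rV[R]_n :=
  \row_i ((z i)%:~R + (q i)%:R / L%:R).

Definition box (M : nat) : pred {ffun 'I_n -> 'I_L} :=
  [pred J : {ffun 'I_n -> 'I_L} | [forall i, (J i < M)%N]].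

Lemma card_box M : (M <= L)%N -> #|box M| = (M ^ n)%N.
Proof.
move=> ML; have -> : #|box M| = #|(ffun_on [pred j : 'I_L | (j < M)%N] : {pred {ffun 'I_n -> 'I_L}})|.
  by apply: eq_card => J; apply/forallP/ffun_onP => h i; exact: h.
rewrite card_ffun_on card_ord; congr (_ ^ _)%N.
by rewrite -sum1_card (big_ord_narrow ML) sum1_card card_ord.
Qed.

(** Orthogonality of the characters of [(Z / L)^n]. In a coordinate [i] where [q] and [q'] differ,
    [h] advances [J] cyclically, which turns the phase by [theta]; the wrap-around from [L - 1] to 0
    is invisible since [L * (q i - q' i) / L] is an integer. *)
Lemma sum_cos_grid_point J' q q' : (0 < L)%N -> q != q' ->
  \sum_J cos (phase (frequency J - frequency J')
    (grid_point q - grid_point q')) = 0.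
Proof.
move=> L0 qq'.
have [i qi] : exists i, q i != q' i.
  apply: contrapT => h; move/eqP: qq'; apply; apply/ffunP => i.
  by apply/eqP/negPn/negP => qi; apply: h; exists i.
pose r : int := (q i : nat)%:Z - (q' i : nat)%:Z.
pose theta : R := 2 * pi * (r%:~R / L%:R).
pose h J : {ffun 'I_n -> 'I_L} := [ffun j => if j == i then ordS (J j) else J j].
apply: (@sum_cos_shift_eq0 _ _ _ h theta).
- move=> J1 J2 /ffunP e; apply/ffunP => j; have := e j; rewrite !ffunE.
  by case: ifP => // _; exact: (can_inj (@ordSK L)).
- move=> c J.
  have [z' hz] : exists z' : int, phase (frequency (h J)) (grid_point q - grid_point q') =
      phase (frequency J) (grid_point q - grid_point q') + theta + 2 * pi * z'%:~R.
    have [z' zE] : exists z' : int,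
        (ordS (J i))%:Z = (J i)%:Z + 1 + L%:Z * z' :> int.
      rewrite /=; case: (ltngtP (J i).+1 L) (ltn_ord (J i)) => // h1 _.
        by exists 0; rewrite modn_small// mulr0 addr0; lia.
      by exists (-1); rewrite h1 modnn mulrN1 -PoszD addn1 h1 subrr.
    exists (r * z'); rewrite /phase /theta (bigD1 i)//= [in RHS](bigD1 i)//=.
    have -> : \sum_(j | j != i) (frequency (h J) j)%:~R * (grid_point q - grid_point q') ord0 j
      = \sum_(j | j != i) (frequency J j)%:~R * (grid_point q - grid_point q') ord0 j.
      by apply: eq_bigr => j ji; rewrite !ffunE (negbTE ji).
    have -> : (frequency (h J) i)%:~R = (frequency J i)%:~R + 1 + L%:R * z'%:~R :> R.
      by rewrite !ffunE eqxx zE !intrD intrM.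
    have -> : (grid_point q - grid_point q') ord0 i = r%:~R / L%:R :> R.
      by rewrite !mxE /r intrB mulrBl; ring.
    rewrite intrM; field.
    by rewrite pnatr_eq0 -lt0n.
  rewrite !phaseBl hz.
  set X := phase _ _; set Y := phase _ _.
  have -> : X + theta + 2 * pi * z'%:~R - Y + c = (X - Y + theta + c) + 2 * pi * z'%:~R by ring.
  exact: cos_periodz.
- apply: cos_rational_neq1 => //.
  have := ltn_ord (q i); have := ltn_ord (q' i).
  have : (q i : nat) <> q' i by move/val_inj => e; move: qi; rewrite e eqxx.
  rewrite /r; lia.
Qed.

(** Parseval's identity for the indicator of [U]: [J] runs over a full period, so the shift by [J']
    has no influence. *)
Lemma sum_sqr_fourier_grid (U : {set {ffun 'I_n -> 'I_L}}) J' : (0 < L)%N ->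
  \sum_J ((\sum_(q in U) cos (phase (frequency J - frequency J') (grid_point q))) ^+ 2
    + (\sum_(q in U) sin (phase (frequency J - frequency J') (grid_point q))) ^+ 2)
  = L%:R ^+ n * #|U|%:R.
Proof.
move=> L0; under eq_bigr do rewrite sqr_sum_cos_sin.
rewrite exchange_big/= -[in RHS]sum1_card natr_sum mulr_sumr.
apply: eq_bigr => q qU; rewrite exchange_big/= (bigD1 q)//=.
rewrite [X in _ + X = _]big1 ?addr0; last first.
  move=> q' /andP[_ qq']; rewrite -[RHS](sum_cos_grid_point J' L0 (q := q) (q' := q')) 1?eq_sym//.
  by apply: eq_bigr => J _; rewrite [in RHS]phaseBr.
under eq_bigr do rewrite subrr cos0.
by rewrite sumr_const card_ffun !card_ord natrX mulr1.
Qed.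

End grid_points.

Lemma sum_dirichlet_kernel L z (B : pred {ffun 'I_n -> 'I_L})
    (U : {set {ffun 'I_n -> 'I_L}}) x :
  \sum_(q in U)
    ((\sum_(J | B J) cos (phase (frequency J) (x - grid_point z q))) ^+ 2
    + (\sum_(J | B J) sin (phase (frequency J) (x - grid_point z q))) ^+ 2)
  = \sum_(J | B J) \sum_(J' | B J')
      (cos (phase (frequency J - frequency J') x) *
        (\sum_(q in U) cos (phase (frequency J - frequency J') (grid_point z q)))
     + sin (phase (frequency J - frequency J') x) *
        (\sum_(q in U) sin (phase (frequency J - frequency J') (grid_point z q)))).
Proof.
under eq_bigr do rewrite sqr_sum_cos_sin.
rewrite exchange_big/=; apply: eq_bigr => J _.
rewrite exchange_big/=; apply: eq_bigr => J' _.
rewrite !mulr_sumr -big_split; apply: eq_bigr => q _ /=.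
by rewrite -phaseBl phaseBr cosB.
Qed.

(** Origin of 24: each of at most three coordinates adds at most [M / L <= 1/24] to the inner
    product of [J] with [x - q], so all phases lie in [[0, pi/4]]. No cancellation occurs: each of
    the [M ^ n] cosines is at least [cos (pi/4)], whose square is 1/2. *)
Lemma dirichlet_kernel_ge L z (M : nat) (q : {ffun 'I_n -> 'I_L}) x :
  (n <= 3)%N -> (0 < M)%N -> (24 * M <= L)%N ->
  (forall i, grid_point z q ord0 i <= x ord0 i < grid_point z q ord0 i + L%:R^-1) ->
  M%:R ^+ (2 * n) / 2 <=
    (\sum_(J | @box L M J) cos (phase (frequency J) (x - grid_point z q))) ^+ 2
    + (\sum_(J | @box L M J) sin (phase (frequency J) (x - grid_point z q))) ^+ 2.
Proof.
move=> n3 M0 ML hx.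
have L0 : (0 < L)%N by lia.
have LR : 0 < L%:R :> R by rewrite ltr0n.
have cos4 : cos (pi / 4) ^+ 2 = 2^-1 :> R.
  have := cos_mulr2n (pi / 4 : R).
  have -> : (pi / 4) *+ 2 = pi / 2 :> R by rewrite -mulr_natr; field.
  by rewrite cos_pihalf -mulr_natr; lra.
have pi4 : 0 <= cos (pi / 4) :> R.
  apply: cos_ge0_pihalf; have := @pi_gt0 R; lra.
have cosJ J : @box L M J -> cos (pi / 4) <= cos (phase (frequency J) (x - grid_point z q)).
  move=> /forallP BJ.
  set y := phase _ _.
  have [y0 y4] : 0 <= y /\ y <= pi / 4.
    have h i : 0 <= (frequency J i)%:~R * (x - grid_point z q) ord0 i <= 24^-1.
      have /andP[h1 h2] := hx i.
      have Ji : (J i : nat)%:R <= M%:R :> R by rewrite ler_nat ltnW.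
      rewrite !mxE in h1 h2 *; rewrite ffunE -pmulrn.
      set u := x ord0 i - _.
      have u0 : 0 <= u by rewrite subr_ge0.
      have u1 : u <= L%:R^-1 by rewrite /u; lra.
      rewrite mulr_ge0//=; apply: le_trans (_ : M%:R * L%:R^-1 <= _).
        exact: ler_pM.
      by rewrite ler_pdivrMr// ler_pdivlMl// -natrM ler_nat.
    rewrite /y /phase; split.
      by rewrite !mulr_ge0 ?pi_ge0// sumr_ge0// => i _; case/andP: (h i).
    have : \sum_i (frequency J i)%:~R * (x - grid_point z q) ord0 i <= 8^-1.
      apply: (@le_trans _ _ (\sum_(i < n) 24^-1)).
        by apply: ler_sum => i _; case/andP: (h i).
      rewrite sumr_const card_ord -mulr_natr.
      have : n%:R <= 3 :> R by rewrite ler_nat.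
      lra.
    have := @pi_gt0 R; set S := \sum_i _ => p0 hS.
    have : pi * S <= pi * 8^-1 by rewrite ler_pM2l.
    rewrite -mulrA; lra.
  have p0 := @pi_gt0 R.
  rewrite leNgt ltr_cos ?in_itv/= -?leNgt//; lra.
have : M%:R ^+ n * cos (pi / 4) <= \sum_(J | @box L M J) cos (phase (frequency J) (x - grid_point z q)).
  rewrite -natrX -(@card_box L); last lia.
  by rewrite mulr_natl -sumr_const; exact: ler_sum.
set S := \sum_(J | @box L M J) cos _; set S' := \sum_(J | @box L M J) sin _ => hS.
have : (M%:R ^+ n * cos (pi / 4)) ^+ 2 <= S ^+ 2.
  rewrite ler_pXn2r// ?nnegrE ?mulr_ge0//; apply: le_trans hS.
  by rewrite mulr_ge0.
rewrite exprMn cos4 -exprM mulnC.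
have := sqr_ge0 S'; lra.
Qed.

End phase.

(** * Half-open cubes and the Lebesgue measure of R^n *)

Lemma countable_bigcup_measurable (d : measure_display) (T : sigmaRingType d)
    (I : countType) (D : set I) (A : I -> set T) :
  (forall i, D i -> measurable (A i)) -> measurable (\bigcup_(i in D) A i).
Proof.
move=> mA; pose B k := if unpickle k is Some i then
  (if `[< D i >] then A i else set0) else set0.
have -> : \bigcup_(i in D) A i = \bigcup_k B k.
  apply/seteqP; split => [x [i Di xi]|x [k _]].
    by exists (pickle i) => //; rewrite /B pickleK; case: asboolP.
  by rewrite /B; case: unpickle => // i; case: asboolP => // Di xi; exists i.
apply: bigcup_measurable => k _; rewrite /B; case: unpickle => [i|]//.
by case: asboolP => [Di|_]; [exact: mA|exact: measurable0].
Qed.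

Section bricks.
Context {R : realType}.

Definition brick (n : nat) (a : 'rV[R]_n) (h : R) : set 'rV[R]_n :=
  [set x | forall i, a ord0 i <= x ord0 i < a ord0 i + h].

Lemma open_measurable_rV (n : nat) (U : set 'rV[R]_n) : open U -> measurable U.
Proof. by move=> oU; apply: sub_sigma_algebra. Qed.

Lemma continuous_measurable_rV (n : nat) (f : 'rV[R]_n -> R) :
  continuous f -> measurable_fun setT f.
Proof.
move=> /continuousP cf; apply: (measurability _ (RGenOpens.measurableE R)).
move=> _ [_ [a [b ->] <-]]; rewrite setTI.
by apply: open_measurable_rV; apply: cf; apply: interval_open.
Qed.

Lemma measurable_brick (n : nat) (a : 'rV[R]_n) (h : R) :
  measurable (brick a h).
Proof.
have -> : brick a h = \bigcap_(i in [set: 'I_n])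
    ((fun x : 'rV[R]_n => x ord0 i) @^-1` `[a ord0 i, a ord0 i + h[).
  by apply/seteqP; split => x hx i => [_|]; have := hx i; rewrite /= in_itv/= => //; apply.
apply: fin_bigcap_measurable => // i _; rewrite -[_ @^-1` _]setTI.
apply: continuous_measurable_rV => //; exact: coord_continuous.
Qed.

Definition lattice_point (n L : nat) (m : {ffun 'I_n -> int}) : 'rV[R]_n :=
  \row_i ((m i)%:~R / L%:R).

Lemma floor_brick (n L : nat) (x : 'rV[R]_n) : (0 < L)%N ->
  brick (lattice_point L [ffun i => Num.floor (x ord0 i * L%:R)]) L%:R^-1 x.
Proof.
move=> L0 i; rewrite mxE ffunE -[X in _ + X]mul1r -mulrDl.
rewrite ler_pdivrMr ?ltr0n// ltr_pdivlMr ?ltr0n//.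
by rewrite floor_le/= -intrD1 floorD1_gt.
Qed.

Lemma brick_ball (n : nat) (a x : 'rV[R]_n) (h e : R) :
  0 < e -> h <= e -> brick a h x -> brick a h `<=` ball x e.
Proof.
move=> e0 he ax y ay; split => // i j; rewrite ord1.
have := ax j; have := ay j; rewrite -ball_normE /ball_/= ltr_norml.
move=> /andP[? ?] /andP[? ?]; apply/andP; split; lra.
Qed.

(** Reduces the measurability of [row_cons] for the Borel sets to bricks, whose preimages are
    rectangles of the product. *)
Lemma open_bigcup_brick (n : nat) (U : set 'rV[R]_n) : open U ->
  U = \bigcup_(p in [set p : nat * {ffun 'I_n -> int} |
        brick (lattice_point p.1.+1 p.2) p.1.+1%:R^-1 `<=` U])
      brick (lattice_point p.1.+1 p.2) p.1.+1%:R^-1.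
Proof.
move=> oU; apply/seteqP; split => [x Ux|x [p /= pU]]; last exact: pU.
have /nbhs_ballP[e /= e0 he] : nbhs x U by exact: open_nbhs_nbhs.
have [L Le] : exists L : nat, L.+1%:R^-1 < e.
  exists (Num.truncn e^-1); rewrite invf_plt ?posrE ?ltr0n//.
  by apply: truncnS_gt.
exists (L, [ffun i => Num.floor (x ord0 i * L.+1%:R)]) => /=; last exact: floor_brick.
apply: subset_trans he; apply: brick_ball => //; first exact: ltW.
exact: floor_brick.
Qed.

End bricks.

Section lebesgue_rV_measure.
Context {R : realType}.

Definition row_cons (n : nat) (p : R * 'rV[R]_n) : 'rV[R]_n.+1 :=
  row_mx p.1%:M p.2.

Lemma row_cons0 (n : nat) (p : R * 'rV[R]_n) : row_cons p ord0 ord0 = p.1.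
Proof.
have -> : (ord0 : 'I_n.+1) = @lshift 1 n ord0 by exact/val_inj.
by rewrite [LHS]row_mxEl mxE eqxx mulr1n.
Qed.

Lemma row_consS (n : nat) (p : R * 'rV[R]_n) (i : 'I_n) :
  row_cons p ord0 (lift ord0 i) = p.2 ord0 i.
Proof.
have -> : lift ord0 i = @rshift 1 n i by exact/val_inj.
by rewrite [LHS]row_mxEr.
Qed.

Lemma preimage_row_cons_brick (n : nat) (a : 'rV[R]_n.+1) (h : R) :
  @row_cons n @^-1` brick a h =
  `[a ord0 ord0, a ord0 ord0 + h[ `*` brick (\row_i a ord0 (lift ord0 i)) h.
Proof.
apply/seteqP; split => [p hp|p [/= p1 p2] i].
  split => [|i]; first by have := hp ord0; rewrite row_cons0 /= in_itv.
  by have := hp (lift ord0 i); rewrite row_consS mxE.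
have [j ->|->] := unliftP ord0 i.
  by rewrite row_consS; have := p2 j; rewrite mxE.
by rewrite row_cons0; move: p1; rewrite in_itv.
Qed.

Lemma measurable_row_cons (n : nat) :
  measurable_fun [set: R * 'rV[R]_n] (@row_cons n).
Proof.
apply: (measurability (@open 'rV[R]_n.+1)) => // _ [U oU <-]; rewrite setTI.
rewrite (open_bigcup_brick oU) preimage_bigcup.
apply: countable_bigcup_measurable => p _; rewrite preimage_row_cons_brick.
by apply: measurableX => //; exact: measurable_brick.
Qed.

Lemma bigcup_brick (n : nat) :
  [set: 'rV[R]_n] = \bigcup_(k : nat) brick (const_mx (- k%:R)) (k%:R *+ 2).
Proof.
apply/seteqP; split => // x _.
pose k := (Num.truncn (\sum_i `|x ord0 i|)).+1.
exists k => // i; rewrite mxE -mulr_natr.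
have : `|x ord0 i| < k%:R.
  apply: le_lt_trans (truncnS_gt _).
  by rewrite (bigD1 i)//= lerDl sumr_ge0.
rewrite ltr_norml => /andP[? ?]; apply/andP; split; lra.
Qed.

(** [lebesgue_rV] is a bare set function. The induction supplies its measure structure, with the
    sigma-finiteness that the next product measure requires, and the volume of cubes, the one
    property used afterwards. *)
Lemma lebesgue_rV_sigma_finite (n : nat) :
  exists2 m : {sigma_finite_measure set 'rV[R]_n -> \bar R},
    @lebesgue_rV R n = m &
    forall a h, 0 <= h -> m (brick a h) = (h ^+ n)%:E.
Proof.
elim: n => [|n [m mE mV]].
  exists (\d_(0 : 'rV[R]_0)) => // a h _; rewrite /= /dirac indicE expr0 mem_set//.
  by case.
pose mu0 := (pushforward (@lebesgue_measure R \x m)%E (@row_cons n)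
  : {measure set 'rV[R]_n.+1 -> \bar R}).
pose mu := mu0 (@measurable_row_cons n).
have muV a h : 0 <= h -> mu (brick a h) = (h ^+ n.+1)%:E.
  move=> h0.
  have -> : mu (brick a h) = (@lebesgue_measure R \x m)%E (`[a ord0 ord0, a ord0 ord0 + h[
      `*` brick (\row_i a ord0 (lift ord0 i)) h) by rewrite -preimage_row_cons_brick.
  rewrite product_measure1E//; last exact: measurable_brick.
  have e : @lebesgue_measure R `[a ord0 ord0, a ord0 ord0 + h[%classic = h%:E.
    rewrite lebesgue_measure_itv/= lte_fin ltrDl.
    case: ltP => h1; last by rewrite -(le_anti (introT andP (conj h0 h1))).
    by rewrite -EFinD addrAC subrr add0r.
  by rewrite exprS EFinM; congr (_ * _)%E; [exact: e|exact: mV].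
have sf : sigma_finite setT mu.
  exists (fun k : nat => brick (const_mx (- k%:R)) (k%:R *+ 2)).
    exact: bigcup_brick.
  move=> k; split; first exact: measurable_brick.
  by rewrite muV ?mulrn_wge0// ltry.
pose mu' : {sigma_finite_measure set 'rV[R]_n.+1 -> \bar R} :=
  HB.pack_for {sigma_finite_measure set 'rV[R]_n.+1 -> \bar R} (Measure.sort mu)
    (Measure.class mu) (Measure_isSigmaFinite.Build _ _ _ (Measure.sort mu) sf).
exists mu' => //.
by rewrite [LHS]/= mE.
Qed.

End lebesgue_rV_measure.

(** * Outer regularity of finite Borel measures *)

Section outer_regularity.
Context {R : realType} {n : nat}.
Variable nu : {finite_measure set 'rV[R]_n -> \bar R}.
Implicit Types A U C : set 'rV[R]_n.

(** Unlike outer regularity alone, approximation from both sides is stable under complement, so that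
    these sets can form a sigma-algebra. *)
Definition tight_set A :=
  measurable A /\ forall e : R, 0 < e -> exists U C,
    [/\ open U, closed C, C `<=` A, A `<=` U & (nu (U `\` C) <= e%:E)%E].

Lemma finite_measure_cvg0 (F : (set 'rV[R]_n)^nat) (e : R) : 0 < e ->
  (forall i, measurable (F i)) ->
  {homo F : n m / (n <= m)%N >-> (m <= n)%O} -> \bigcap_k F k = set0 ->
  exists k, (nu (F k) <= e%:E)%E.
Proof.
move=> e0 mF dF F0.
have f0 : (nu (F 0%N) < +oo)%E by rewrite ltey_eq fin_num_measure.
have := nonincreasing_cvg_mu f0 mF _ dF.
rewrite F0 measure0 => /(_ measurable0) c.
have : (\forall k \near \oo, nu (F k) < e%:E)%E.
  have /fine_cvgP[nf /cvgr_lt/(_ _ e0)] := c.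
  apply: filterS2 nf => k fk h.
  by change (nu (F k)) with ((nu \o F) k); rewrite -(fineK fk) lte_fin.
by move=> [k _ /(_ k (leqnn k)) h]; exists k; exact: ltW.
Qed.

Lemma tight_open U : open U -> tight_set U.
Proof.
move=> oU; split; first exact: open_measurable_rV.
move=> e e0.
pose C k := [set x : 'rV[R]_n | ball x k.+1%:R^-1 `<=` U].
have cC k : closed (C k).
  have -> : C k = ~` [set x | exists2 y, ~ U y & ball x k.+1%:R^-1 y].
    apply/seteqP; split => [x h [y Uy /h]//|x h y xy].
    by apply: contrapT => Uy; apply: h; exists y.
  apply: open_closedC; rewrite openE => x [y Uy xy].
  have oB : open (ball y k.+1%:R^-1) by apply: ball_open; rewrite invr_gt0.
  have : nbhs x (ball y k.+1%:R^-1).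
    by apply: open_nbhs_nbhs; split => //; exact: ball_sym.
  by apply: filterS => x' /ball_sym yx'; exists y.
have [|||k hk] := @finite_measure_cvg0 (fun k => U `\` C k) e e0.
- move=> k; apply: measurableD; first exact: open_measurable_rV.
  by rewrite -(setCK (C k)); apply: measurableC; apply: open_measurable_rV; exact: closed_openC.
- move=> i j ij; apply/subsetPset => x [Ux Cx]; split => // h; apply: Cx.
  apply: subset_trans h; apply: le_ball.
  by rewrite lef_pV2 ?posrE ?ltr0n// ler_nat.
- apply/seteqP; split => // x h; have [Ux _] := h 0%N I.
  have /nbhs_ballP[r /= r0 hr] : nbhs x U by exact: open_nbhs_nbhs.
  have [_] := h (Num.truncn r^-1) I; apply; apply: subset_trans hr; apply: le_ball.
  by apply/ltW; rewrite invf_plt ?posrE ?ltr0n// truncnS_gt.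
exists U, (C k); split => // x Cx; apply: Cx; apply: ballxx.
by rewrite invr_gt0.
Qed.

Lemma tight_sigma_algebra : sigma_algebra setT tight_set.
Proof.
split.
- split; first exact: measurable0.
  move=> e e0; exists set0, set0; split => //.
  + exact: closed0.
  + by rewrite setD0 measure0 lee_fin ltW.
- move=> A [mA hA]; rewrite setTD; split; first exact: measurableC.
  move=> e e0; have [U [C [oU cC CA AU h]]] := hA _ e0.
  exists (~` C), (~` U); split.
  + exact: closed_openC.
  + exact: open_closedC.
  + exact: subsetC.
  + exact: subsetC.
  + by rewrite setDE setCK setIC -setDE.
- move=> A hA; split; first by apply: bigcup_measurable => i _; case: (hA i).
  move=> e e0.
  (* One half of [e] pays for the approximations of all the [A i], with geometric weights; the other
     half for replacing the union of the [C i], which need not be closed, by a finite one. *)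
  have e2 : 0 < e / 2 by rewrite divr_gt0.
  have ei i : 0 < e / 2 / (2 ^ i.+1)%:R by rewrite divr_gt0// ltr0n expn_gt0.
  have /choice[U hU] : forall i, exists U, exists C,
      [/\ open U, closed C, C `<=` A i, A i `<=` U
        & (nu (U `\` C) <= (e / 2 / (2 ^ i.+1)%:R)%:E)%E].
    by move=> i; have [_ h] := hA i; exact: h.
  have /choice[C hC] : forall i, exists C,
      [/\ open (U i), closed C, C `<=` A i, A i `<=` U i
        & (nu (U i `\` C) <= (e / 2 / (2 ^ i.+1)%:R)%:E)%E] by exact: hU.
  have mU i : measurable (U i) by case: (hC i) => oU *; exact: open_measurable_rV.
  have mC i : measurable (C i).
    case: (hC i) => _ cC *; rewrite -(setCK (C i)); apply: measurableC.
    by apply: open_measurable_rV; exact: closed_openC.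
  have mUU : measurable (\bigcup_i U i) by exact: bigcup_measurable.
  pose V := \bigcup_i U i `\` \bigcup_i C i.
  have mV : measurable V by apply: measurableD => //; exact: bigcup_measurable.
  have hV : (nu V <= (e / 2)%:E)%E.
    apply: (@le_trans _ _ (\sum_(0 <= i <oo) nu (U i `\` C i))%E).
      apply: measure_sigma_subadditive => //.
        by move=> i; exact: measurableD.
      by move=> x [[i _ Ux] Cx]; exists i => //; split => // h; apply: Cx; exists i.
    apply: le_trans (epsilon_trick0 xpredT (ltW e2)).
    by apply: lee_nneseries => // i _; case: (hC i).
  pose D k := \big[setU/set0]_(i < k) C i.
  have mD k : measurable (D k) by apply: bigsetU_measurable.
  have [|||k hk] := @finite_measure_cvg0 (fun k => \bigcup_i C i `\` D k) _ e2.
  + by move=> k; apply: measurableD => //; exact: bigcup_measurable.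
  + move=> i j ij; apply/subsetPset => x [Cx Dx]; split => // h; apply: Dx.
    by apply: (subset_bigsetU ij).
  + apply/seteqP; split => // x h.
    have [[i _ Ci] _] := h 0%N I.
    have [_] := h i.+1 I; apply; rewrite /D -bigcup_mkord; exists i => //=.
  exists (\bigcup_i U i), (D k); split.
  + by apply: bigcup_open => i _; case: (hC i).
  + by apply: closed_bigsetU => i _; case: (hC i).
  + rewrite /D -bigcup_mkord => x [i _ Cx]; exists i => //; case: (hC i) => _ _ + _ _; exact.
  + by move=> x [i _ Ax]; exists i => //; case: (hC i) => _ _ _ + _; exact.
  + apply: (@le_trans _ _ (nu (V `|` (\bigcup_i C i `\` D k)))).
      apply: le_measure; rewrite ?inE.
      * exact: measurableD.
      * by apply: measurableU => //; apply: measurableD => //; exact: bigcup_measurable.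
      * move=> x [Ux Dx]; have [Cx|Cx] := pselect ((\bigcup_i C i) x); [by right|by left].
    apply: le_trans (measureU2 _ _ _) _ => //.
      by apply: measurableD => //; exact: bigcup_measurable.
    by rewrite [e]splitr EFinD leeD.
Qed.

Lemma finite_measure_outer_regular (A : set 'rV[R]_n) (e : R) :
  measurable A -> 0 < e ->
  exists U, [/\ open U, A `<=` U & (nu U <= nu A + e%:E)%E].
Proof.
move=> mA e0.
have [_ /(_ e e0)[U [C [oU cC CA AU h]]]] : tight_set A.
  by apply: (smallest_sub tight_sigma_algebra _ mA) => U; exact: tight_open.
exists U; split => //.
have mU := open_measurable_rV oU.
have mC : measurable C.
  rewrite -(setCK C); apply: measurableC.
  by apply: open_measurable_rV; exact: closed_openC.
apply: (@le_trans _ _ (nu (A `|` (U `\` C)))).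
  apply: le_measure; rewrite ?inE//.
    by apply: measurableU => //; exact: measurableD.
  by move=> x Ux; have [/CA|] := pselect (C x); [left|right].
apply: le_trans (measureU2 _ _ _) _ => //; first exact: measurableD.
exact: leeD.
Qed.

End outer_regularity.

(** * Fourier coefficients of a finite measure and its mass on small cubes *)

Lemma integrable_sumR (d : measure_display) (T : measurableType d)
    (R : realType) (mu : {measure set T -> \bar R}) (D : set T) (I : Type)
    (s : seq I) (p : pred I) (f : I -> T -> R) :
  measurable D -> (forall i, mu.-integrable D (EFin \o f i)) ->
  mu.-integrable D (EFin \o (fun x => \sum_(i <- s | p i) f i x)).
Proof.
move=> mD fi.
have -> : EFin \o (fun x => \sum_(i <- s | p i) f i x) =
    (fun x => \sum_(i <- s | p i) (EFin \o f i) x)%E.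
  by apply/funext => x /=; rewrite sumEFin.
exact: integrable_sum.
Qed.

Lemma Rintegral_sum (d : measure_display) (T : measurableType d)
    (R : realType) (mu : {measure set T -> \bar R}) (D : set T) (I : Type)
    (s : seq I) (p : pred I) (f : I -> T -> R) :
  measurable D -> (forall i, mu.-integrable D (EFin \o f i)) ->
  \int[mu]_(x in D) (\sum_(i <- s | p i) f i x) =
  \sum_(i <- s | p i) \int[mu]_(x in D) f i x.
Proof.
move=> mD fi; elim: s => [|i s IH].
  rewrite big_nil; under eq_Rintegral do rewrite big_nil.
  by rewrite Rintegral_cst// mul0r.
rewrite big_cons -IH; under eq_Rintegral do rewrite big_cons.
case: ifP => // _; rewrite RintegralD//; exact: integrable_sumR.
Qed.

Section fourier.
Context {R : realType} {n : nat}.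
Implicit Types (nu : MF R n) (k : {ffun 'I_n -> int}) (x : 'rV[R]_n).

Lemma continuous_phase k : continuous (phase k : 'rV[R]_n -> R).
Proof.
have c i : continuous (fun x : 'rV[R]_n => (k i)%:~R * x ord0 i : R).
  by move=> x; exact: (continuous_comp (@coord_continuous _ _ _ _ _ _) (@mulrl_continuous _ _ _)).
have cs : continuous (fun x : 'rV[R]_n => \sum_i (k i)%:~R * x ord0 i : R).
  by apply: continuous_big => // x; exact: add_continuous.
by move=> x; exact: (continuous_comp (cs _) (@mulrl_continuous _ _ _)).
Qed.

Lemma integrable_Cb nu (f : 'rV[R]_n -> R) :
  Cb f -> nu.-integrable setT (EFin \o f).
Proof.
move=> [cf bf]; apply: measurable_bounded_integrable => //.
- by rewrite ltey_eq fin_num_measure.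
- exact: continuous_measurable_rV.
Qed.

Lemma bounded_fun_le (f : 'rV[R]_n -> R) (c : R) :
  (forall x, `|f x| <= c) -> bounded_fun f.
Proof.
move=> fc; exists c; split; first exact: num_real.
by move=> y cy x _; apply: le_trans (fc x) (ltW cy).
Qed.

Lemma Cb_cos_phase k : Cb (fun x => cos (phase k x)).
Proof.
split; last by apply: (@bounded_fun_le _ 1) => x; exact: cos_max.
by move=> x; apply: continuous_comp; [exact: continuous_phase|exact: continuous_cos].
Qed.

Lemma Cb_sin_phase k : Cb (fun x => sin (phase k x)).
Proof.
split; last by apply: (@bounded_fun_le _ 1) => x; exact: sin_max.
by move=> x; apply: continuous_comp; [exact: continuous_phase|exact: continuous_sin].
Qed.

Definition fourier_power nu k : R :=
  pairing nu (fun x => cos (phase k x)) ^+ 2 +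
  pairing nu (fun x => sin (phase k x)) ^+ 2.

(** The Fejer mean of the squared Fourier coefficients. Indices have the type of the grid of mesh
    [1 / (24 * M)], for use with the discrete orthogonality; [box] keeps those below [M]. *)
Definition mean_power nu (M : nat) : R :=
  (M%:R ^+ n)^-1 * \sum_(J in @box n (24 * M) M) \sum_(J' in @box n (24 * M) M)
    fourier_power nu (frequency J - frequency J').

Definition subcubes (L : nat) (z : {ffun 'I_n -> int})
    (U : {set {ffun 'I_n -> 'I_L}}) : set 'rV[R]_n :=
  \bigcup_(q in [set q | q \in U]) brick (grid_point z q) L%:R^-1.

Lemma measurable_subcubes L z (U : {set {ffun 'I_n -> 'I_L}}) :
  measurable (subcubes z U).
Proof.
apply: countable_bigcup_measurable => q _; exact: measurable_brick.
Qed.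

(* With [u_k, v_k] the discrete Fourier coefficients of [U], the integral of
   the sum of the kernels centred at [U] is [sum (a_k u_k + b_k v_k)], and the
   sum of the squares of [u_k, v_k] is controlled by orthogonality. *)
Lemma measure_subcubes_le nu (M : nat) z
    (U : {set {ffun 'I_n -> 'I_(24 * M)}}) (sigma : R) :
  (n <= 3)%N -> (0 < M)%N -> 0 < sigma ->
  (nu (subcubes z U) <= (sigma * mean_power nu M +
     24 ^+ (2 * n) / sigma * (#|U|%:R / (24 * M)%:R ^+ n))%:E)%E.
Proof.
move=> n3 M0 s0; set L := (24 * M)%N in U *.
have L0 : (0 < L)%N by rewrite muln_gt0.
have MR : 0 < M%:R :> R by rewrite ltr0n.
have LR : 0 < L%:R :> R by rewrite ltr0n.
pose B := @box n L M.
pose c k := pairing nu (fun x => cos (phase k x)).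
pose s k := pairing nu (fun x => sin (phase k x)).
pose u k := \sum_(q in U) cos (phase k (grid_point z q) : R).
pose v k := \sum_(q in U) sin (phase k (grid_point z q) : R).
pose fr (J J' : {ffun 'I_n -> 'I_L}) := frequency J - frequency J'.
pose G J J' x := cos (phase (fr J J') x) * u (fr J J')
  + sin (phase (fr J J') x) * v (fr J J').
have iG J J' : nu.-integrable setT (EFin \o G J J').
  have -> : EFin \o G J J' = (fun x => (u (fr J J'))%:E * (EFin \o (fun x => cos (phase (fr J J') x))) x
      + (v (fr J J'))%:E * (EFin \o (fun x => sin (phase (fr J J') x))) x)%E.
    by apply/funext => x /=; rewrite -!EFinM -EFinD /G ![in RHS](mulrC (_ (fr J J'))).
  apply: integrableD => //; apply: integrableZl => //; apply: integrable_Cb.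
    exact: Cb_cos_phase.
  exact: Cb_sin_phase.
have GE J J' : \int[nu]_x G J J' x = c (fr J J') * u (fr J J') + s (fr J J') * v (fr J J').
  have ic := integrable_Cb nu (Cb_cos_phase (fr J J')).
  have is_ := integrable_Cb nu (Cb_sin_phase (fr J J')).
  rewrite RintegralD//.
  - by rewrite !RintegralZr.
  - have -> : EFin \o (fun x => cos (phase (fr J J') x) * u (fr J J')) =
      (fun x => (u (fr J J'))%:E * (EFin \o (fun x => cos (phase (fr J J') x))) x)%E.
      by apply/funext => x /=; rewrite -EFinM mulrC.
    exact: integrableZl.
  - have -> : EFin \o (fun x => sin (phase (fr J J') x) * v (fr J J')) =
      (fun x => (v (fr J J'))%:E * (EFin \o (fun x => sin (phase (fr J J') x))) x)%E.
      by apply/funext => x /=; rewrite -EFinM mulrC.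
    exact: integrableZl.
pose h x := \sum_(J in B) \sum_(J' in B) G J J' x.
have ih : nu.-integrable setT (EFin \o h).
  by apply: integrable_sumR => // J; apply: integrable_sumR.
have hE : \int[nu]_x h x = \sum_(J in B) \sum_(J' in B)
    (c (fr J J') * u (fr J J') + s (fr J J') * v (fr J J')).
  rewrite Rintegral_sum//; last by move=> J; exact: integrable_sumR.
  apply: eq_bigr => J _; rewrite Rintegral_sum//.
  by apply: eq_bigr => J' _; exact: GE.
have hK x : h x = \sum_(q in U)
    ((\sum_(J in B) cos (phase (frequency J) (x - grid_point z q))) ^+ 2
    + (\sum_(J in B) sin (phase (frequency J) (x - grid_point z q))) ^+ 2).
  by rewrite sum_dirichlet_kernel.
have h0 x : 0 <= h x.
  by rewrite hK sumr_ge0// => q _; rewrite addr_ge0// sqr_ge0.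
have mE := measurable_subcubes z U.
pose K : R := M%:R ^+ (2 * n) / 2.
have hge x : K * \1_(subcubes z U) x <= h x.
  rewrite indicE; have [|_] := boolP (x \in _); last by rewrite mulr0.
  rewrite inE => -[q /= qU xq]; rewrite mulr1 hK (bigD1 q)//=.
  rewrite -[leLHS]addr0 lerD//; first exact: dirichlet_kernel_ge.
  by rewrite sumr_ge0// => q' _; rewrite addr_ge0// sqr_ge0.
have nuf := fin_num_measure nu (subcubes z U) mE.
have i1 : nu.-integrable setT (EFin \o \1_(subcubes z U)).
  exact: integrable_indic.
have le1 : K * fine (nu (subcubes z U)) <= \int[nu]_x h x.
  have -> : fine (nu (subcubes z U)) = \int[nu]_x \1_(subcubes z U) x.
    by rewrite /Rintegral integral_indic// setIT.
  rewrite -RintegralZl//; apply: le_Rintegral => //.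
  have -> : EFin \o (fun x => K * \1_(subcubes z U) x) =
      (fun x => K%:E * (EFin \o \1_(subcubes z U)) x)%E by [].
  exact: integrableZl.
(* The weight in [a * b <= tau * a ^+ 2 + b ^+ 2 / (4 * tau)]; division by [K] turns [tau * M ^ n]
   into [sigma]. *)
pose tau := sigma * M%:R ^+ n / 2.
have tau0 : 0 < tau by rewrite divr_gt0// mulr_gt0// exprn_gt0.
have le2 : \int[nu]_x h x <= tau * (M%:R ^+ n * mean_power nu M) +
    (4 * tau)^-1 * (M%:R ^+ n * (L%:R ^+ n * #|U|%:R)).
  have -> : M%:R ^+ n * mean_power nu M = \sum_(J in B) \sum_(J' in B) fourier_power nu (fr J J').
    by rewrite /mean_power mulrA divff ?mul1r// expf_neq0// gt_eqF.
  (* For each of the [M ^ n] indices [J'], the sum over [J] is enlarged from the box to the full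
     period, where Parseval's identity applies. *)
  have : \sum_(J' in B) \sum_(J in B) (u (fr J J') ^+ 2 + v (fr J J') ^+ 2) <=
      M%:R ^+ n * (L%:R ^+ n * #|U|%:R).
    rewrite -natrX -(@card_box n L M); last by rewrite /L; lia.
    rewrite mulr_natl -sumr_const; apply: ler_sum => J' _.
    rewrite -(sum_sqr_fourier_grid z U J' L0) [leRHS](bigID B)/= lerDl.
    by rewrite sumr_ge0// => J _; rewrite addr_ge0// sqr_ge0.
  rewrite exchange_big/= => huv.
  apply: le_trans (_ : _ <= tau * (\sum_(J in B) \sum_(J' in B) fourier_power nu (fr J J')) +
    (4 * tau)^-1 * \sum_(J in B) \sum_(J' in B) (u (fr J J') ^+ 2 + v (fr J J') ^+ 2)) _; last first.
    by rewrite lerD2l ler_pM2l// invr_gt0 mulr_gt0.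
  rewrite hE !mulr_sumr -big_split; apply: ler_sum => J _ /=.
  rewrite !mulr_sumr -big_split; apply: ler_sum => J' _ /=.
  have amgm a b : a * b <= tau * a ^+ 2 + (4 * tau)^-1 * b ^+ 2.
    rewrite -subr_ge0.
    have -> : tau * a ^+ 2 + (4 * tau)^-1 * b ^+ 2 - a * b =
      (4 * tau)^-1 * (2 * tau * a - b) ^+ 2 by field; rewrite gt_eqF.
    by rewrite mulr_ge0 ?sqr_ge0// invr_ge0 mulr_ge0// ltW.
  rewrite /fourier_power -/(c _) -/(s _) !mulrDr.
  have := amgm (c (fr J J')) (u (fr J J')); have := amgm (s (fr J J')) (v (fr J J')).
  lra.
rewrite -(fineK nuf) lee_fin.
have K0 : 0 < K by rewrite divr_gt0// exprn_gt0.
rewrite -(ler_pM2l K0); apply: le_trans le1 (le_trans le2 _).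
rewrite le_eqVlt; apply/orP; left; apply/eqP.
rewrite /K /tau /L natrM exprMn [(2 * n)%N]mulnC !exprM.
set X := M%:R ^+ n; set Y := 24 ^+ n.
have X0 : X != 0 by rewrite expf_neq0// gt_eqF.
have Y0 : Y != 0 by rewrite expf_neq0// pnatr_eq0.
by field; rewrite X0 Y0 gt_eqF.
Qed.

End fourier.

(** * Absolute continuity from bounded Fejer means *)

Section absolute_continuity_criterion.
Context {R : realType} {n : nat}.
Implicit Types (nu : MF R n) (z : {ffun 'I_n -> int}).

Definition unit_cell z : set 'rV[R]_n := brick (lattice_point 1 z) 1.

Lemma subcubes_unit_cell L z (U : {set {ffun 'I_n -> 'I_L}}) : (0 < L)%N ->
  subcubes z U `<=` unit_cell z.
Proof.
move=> L0 x [q _ xq] i; have /andP[h1 h2] := xq i.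
rewrite !mxE divr1 in h1 h2 *.
have LR : 0 < L%:R :> R by rewrite ltr0n.
have q0 : 0 <= (q i)%:R / L%:R :> R by rewrite divr_ge0.
have : (q i)%:R / L%:R + L%:R^-1 <= 1 :> R.
  by rewrite -[X in _ + X]mul1r -mulrDl ler_pdivrMr// mul1r natr1 ler_nat.
move=> q1; apply/andP; split; lra.
Qed.

Lemma exists_subcube L z (x : 'rV[R]_n) : (0 < L)%N -> unit_cell z x ->
  exists q : {ffun 'I_n -> 'I_L}, brick (grid_point z q) L%:R^-1 x.
Proof.
move=> L0 xz; have LR : 0 < L%:R :> R by rewrite ltr0n.
have /choice[q hq] : forall i, exists q : 'I_L,
    (q : nat)%:R / L%:R <= x ord0 i - (z i)%:~R < (q : nat)%:R / L%:R + L%:R^-1.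
  move=> i; have /andP[h1 h2] := xz i; rewrite !mxE divr1 in h1 h2.
  set y := x ord0 i - _.
  have y0 : 0 <= y by rewrite subr_ge0.
  have y1 : y < 1 by rewrite /y; lra.
  have qL : (Num.truncn (y * L%:R) < L)%N.
    by rewrite truncn_lt_nat ?mulr_ge0// gtr_pMl.
  exists (Ordinal qL) => /=.
  rewrite -[X in _ + X]mul1r -mulrDl ler_pdivrMr// ltr_pdivlMr// natr1.
  by rewrite truncnS_gt andbT truncn_le mulr_ge0// ltW.
exists (finfun q) => i; have := hq i.
rewrite !mxE ffunE => /andP[? ?]; apply/andP; split; lra.
Qed.

Lemma trivIset_subcube L z (D : set {ffun 'I_n -> 'I_L}) : (0 < L)%N ->
  trivIset D (fun q => brick (grid_point z q : 'rV[R]_n) L%:R^-1).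
Proof.
move=> L0 q q' _ _ [x [xq xq']]; apply/ffunP => i.
have LR : 0 < L%:R :> R by rewrite ltr0n.
have := xq i; have := xq' i; rewrite !mxE => /andP[h1 h2] /andP[h3 h4].
have lt (a b : 'I_L) : (a : nat)%:R / L%:R < (b : nat)%:R / L%:R + L%:R^-1 :> R -> (a <= b)%N.
  by rewrite -[X in _ + X]mul1r -mulrDl ltr_pM2r ?invr_gt0// natr1 ltr_nat ltnS.
apply/val_inj/anti_leq; apply/andP; split; apply: lt; lra.
Qed.

Lemma measure_subcubes (m : {measure set 'rV[R]_n -> \bar R}) L z
    (U : {set {ffun 'I_n -> 'I_L}}) : (0 < L)%N ->
  (forall a h, 0 <= h -> m (brick a h) = (h ^+ n)%:E) ->
  m (subcubes z U) = (#|U|%:R / L%:R ^+ n)%:E.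
Proof.
move=> L0 mV.
have mB (q : {ffun 'I_n -> 'I_L}) : measurable (brick (grid_point z q : 'rV[R]_n) L%:R^-1).
  exact: measurable_brick.
have -> : subcubes z U = \big[setU/set0]_(q <- enum U) brick (grid_point z q : 'rV[R]_n) L%:R^-1.
  rewrite -bigcup_seq /subcubes; congr bigcup.
  by apply/seteqP; split => q /=; rewrite mem_enum.
rewrite -[LHS]mul1e -integral_cst; last exact: bigsetU_measurable.
rewrite ge0_integral_bigsetU//; last 2 first.
- exact: enum_uniq.
- exact: trivIset_subcube.
rewrite (eq_bigr (fun=> ((L%:R^-1 : R) ^+ n)%:E)); last first.
  by move=> q _; rewrite integral_cst// mul1e; apply: mV; rewrite invr_ge0.
by rewrite sumEFin big_enum sumr_const exprVn mulr_natl.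
Qed.

Lemma unit_cell_bigcup : [set: 'rV[R]_n] = \bigcup_z unit_cell z.
Proof.
apply/seteqP; split => // x _.
exists [ffun i => Num.floor (x ord0 i * 1%:R)] => //.
by have := @floor_brick R n 1 x isT; rewrite invr1.
Qed.

(* A null set of a unit cell is covered by an open set of small volume, whose
   inner approximations by subcubes are controlled by [measure_subcubes_le]. *)
Lemma mean_power_null_cell nu (m : {measure set 'rV[R]_n -> \bar R}) z
    (C sigma e : R) (A : set 'rV[R]_n) :
  (n <= 3)%N ->
  (forall a h, 0 <= h -> m (brick a h) = (h ^+ n)%:E) ->
  (forall N, exists2 M, (N < M)%N & mean_power nu M <= C) ->
  measurable A -> m A = 0 -> 0 < sigma -> 0 < e ->
  (nu (A `&` unit_cell z) <= (sigma * C + 24 ^+ (2 * n) / sigma * e)%:E)%E.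
Proof.
move=> n3 mV hC mA A0 s0 e0.
have mcell : measurable (unit_cell z) by exact: measurable_brick.
have cellV : m (unit_cell z) = 1%E by rewrite mV// expr1n.
have celloo : (m (unit_cell z) < +oo)%E by rewrite cellV ltry.
(* Outer regularity is available for finite measures, hence the restriction of [m] to the cell. *)
pose rho : {finite_measure set 'rV[R]_n -> \bar R} := mfrestr mcell celloo.
have rhoE B : rho B = m (B `&` unit_cell z) by [].
have [V [oV AV rV]] := finite_measure_outer_regular rho mA e0.
have rV' : (rho V <= e%:E)%E.
  apply: le_trans rV _; rewrite rhoE.
  have -> : m (A `&` unit_cell z) = 0%E.
    apply/eqP; rewrite eq_le measure_ge0 andbT -A0.
    by apply: le_measure; rewrite ?inE//; exact: measurableI.
  by rewrite add0e.
have mV' := open_measurable_rV oV.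
have /choice[M /all_and2[NM MC]] : forall N, exists M, (N < M)%N /\ mean_power nu M <= C.
  by move=> N; have [M] := hC N; exists M.
have M0 j : (0 < M j)%N by exact: leq_ltn_trans (NM j).
pose U j := [set q : {ffun 'I_n -> 'I_(24 * M j)} |
  `[< brick (grid_point z q : 'rV[R]_n) (24 * M j)%:R^-1 `<=` V >] ]%SET.
have L0 j : (0 < 24 * M j)%N by rewrite muln_gt0/=.
have Ue j : #|U j|%:R / (24 * M j)%:R ^+ n <= e.
  rewrite -lee_fin -(measure_subcubes (m := m) z)//.
  apply: le_trans rV'; rewrite rhoE; apply: le_measure; rewrite ?inE.
  - exact: measurable_subcubes.
  - exact: measurableI.
  - move=> x xU; split; last exact: subcubes_unit_cell xU.
    by case: xU => q /=; rewrite inE => /asboolP; exact.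
have nuU j : (nu (subcubes z (U j)) <= (sigma * C + 24 ^+ (2 * n) / sigma * e)%:E)%E.
  apply: le_trans (measure_subcubes_le nu z (U j) n3 (M0 j) s0) _.
  rewrite lee_fin lerD//; first by rewrite ler_pM2l.
  apply: ler_wpM2l; last exact: Ue.
  by apply: divr_ge0; [exact: exprn_ge0|exact: ltW].
have mAc : measurable (A `&` unit_cell z) by exact: measurableI.
have indE B : measurable B -> nu B = (\int[nu]_x (\1_B x)%:E)%E.
  by move=> mB; rewrite integral_indic// setIT.
rewrite indE//.
(* The approximations need not increase with [j], but each point of [V] in the cell lies in all of
   them from some [j] on, since the mesh tends to 0; Fatou's lemma then suffices. *)
apply: (ae_le_integral_fatou (f := fun j x => (\1_(subcubes z (U j)) x)%:E)) => //.
- move=> j; apply/measurable_EFinP; apply: measurable_indic.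
  exact: measurable_subcubes.
- by apply/measurable_EFinP; exact: measurable_indic.
- apply: aeW => x _; rewrite indicE; have [|_] := boolP (x \in _); last first.
    by apply: nearW => j; rewrite lee_fin.
  rewrite inE => -[Ax xz].
  have /nbhs_ballP[r /= r0 hr] : nbhs x V by apply: open_nbhs_nbhs; split => //; exact: AV.
  have : \forall j \near \oo, r^-1 < j%:R by exact: nbhs_infty_gtr.
  apply: filterS => j rj; rewrite lee_fin indicE mem_set//.
  have [q xq] := exists_subcube (L0 j) xz.
  exists q => //=; rewrite inE; apply/asboolP.
  apply: subset_trans hr; apply: brick_ball => //.
  rewrite -[leRHS]invrK lef_pV2 ?posrE ?invr_gt0 ?ltr0n//.
  apply: (le_trans (ltW rj)); rewrite ler_nat.
  by have := NM j; lia.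
- by move=> j; rewrite -indE; [exact: nuU|exact: measurable_subcubes].
Qed.

Lemma mean_power_null_dominates nu (C : R) : (n <= 3)%N ->
  (forall N, exists2 M, (N < M)%N & mean_power nu M <= C) ->
  nu `<< @lebesgue_rV R n.
Proof.
move=> n3 hC; have [m -> mV] := @lebesgue_rV_sigma_finite R n.
apply/null_content_dominatesP => A mA A0.
have cell0 z : nu (A `&` unit_cell z) = 0%E.
  apply/eqP; rewrite eq_le measure_ge0 andbT; apply/lee_addgt0Pr => t t0.
  rewrite add0e.
  (* A positive bound, so that division is possible; [sigma] and [e] are then such that each of the
     two terms equals [t / 2]. *)
  pose C1 := Num.max C 0 + 1.
  have C1C : C <= C1 by rewrite /C1; have := (le_max C C 0); rewrite lexx; lra.
  have C10 : 0 < C1 by rewrite ltr_wpDl// le_max lexx orbT.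
  pose sigma := t / 2 / C1.
  have s0 : 0 < sigma by rewrite !divr_gt0.
  pose e := sigma * (t / 2) / 24 ^+ (2 * n).
  have e0 : 0 < e by rewrite divr_gt0 ?exprn_gt0// mulr_gt0// divr_gt0.
  have hC1 N : exists2 M, (N < M)%N & mean_power nu M <= C1.
    by have [M NM MC] := hC N; exists M => //; exact: le_trans C1C.
  apply: le_trans (mean_power_null_cell z n3 mV hC1 mA A0 s0 e0) _.
  rewrite lee_fin /e /sigma le_eqVlt; apply/orP; left; apply/eqP.
  have Y0 : 24 ^+ (2 * n) != 0 :> R by rewrite expf_neq0// pnatr_eq0.
  by field; rewrite Y0 !gt_eqF.
have : nu.-negligible A.
  pose B k := if unpickle k is Some z then A `&` unit_cell z else set0.
  apply: (@negligibleS _ _ _ _ (\bigcup_k B k)) => [x Ax|].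
    have [z _ xz] : (\bigcup_z unit_cell z) x by rewrite -unit_cell_bigcup.
    by exists (pickle z) => //; rewrite /B pickleK.
  apply: negligible_bigcup => k; rewrite /B; case: unpickle => [z|]; last exact: negligible_set0.
  exists (A `&` unit_cell z); split; [|exact: cell0|by []].
  by apply: measurableI => //; exact: measurable_brick.
by move/negligibleP; exact.
Qed.

End absolute_continuity_criterion.

(** * Sums of [|k|^-4] over differences of lattice points *)

Section lattice_sums.
Context {R : realType} {n : nat}.
Implicit Types (k : {ffun 'I_n -> int}).

Definition sqnorm k : R := \sum_i (k i)%:~R ^+ 2.

Definition ball_inf (h : nat) : pred {ffun 'I_n -> int} :=
  [pred k : {ffun 'I_n -> int} | [forall i, (`|k i| < h)%N]].

Lemma card_ord_dist_le (L h : nat) (c : 'I_L) :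
  (#|[pred j : 'I_L | (`|(j : nat)%:Z - (c : nat)%:Z| < h)%N]| <= 2 * h)%N.
Proof.
rewrite cardE -(size_map val) -(size_iota (c - h) (2 * h)).
apply: uniq_leq_size; first by rewrite map_inj_uniq ?enum_uniq//; exact: val_inj.
move=> _ /mapP[j + ->]; rewrite mem_enum inE mem_iota /=; lia.
Qed.

Lemma card_ball_inf_le (L h : nat) (J' : {ffun 'I_n -> 'I_L}) :
  (#|[pred J : {ffun 'I_n -> 'I_L} | ball_inf h (frequency J - frequency J')%R]| <= (2 * h) ^ n)%N.
Proof.
pose F i := [pred j : 'I_L | (`|(j : nat)%:Z - (J' i : nat)%:Z| < h)%N].
have -> : #|[pred J : {ffun 'I_n -> 'I_L} | ball_inf h (frequency J - frequency J')%R]| =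
    #|(family F : {pred {ffun 'I_n -> 'I_L}})|.
  apply: eq_card => J; rewrite !inE.
  by apply/forallP/familyP => H i; have := H i; rewrite !inE !ffunE.
rewrite card_family foldrE big_map.
have -> : ((2 * h) ^ n = \prod_(i <- enum 'I_n) (2 * h))%N.
  by rewrite big_enum /= prod_nat_const card_ord.
by apply: leq_prod => i _; exact: card_ord_dist_le.
Qed.

(* A shell [2 ^ (l - 1) <= |k| < 2 ^ l] is charged to the ball of radius
   [2 ^ l]. *)
Lemma sqnorm_inv_le (M : nat) k : k != 0 -> ball_inf M k ->
  (sqnorm k ^+ 2)^-1 <=
    \sum_(l < M.+1) 16 * (16 ^+ l)^-1 * (ball_inf (2 ^ l) k)%:R :> R.
Proof.
move=> k0 /forallP kM.
have [i0 ki0] : exists i, k i != 0.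
  apply: contrapT => h; move/eqP: k0; apply; apply/ffunP => i; rewrite ffunE.
  by apply/eqP/negPn/negP => ki; apply: h; exists i.
pose i1 := [arg max_(i > i0) `|k i|%N].
pose m := `|k i1|%N.
have km i : (`|k i| <= m)%N by rewrite /m /i1; case: arg_maxnP => // i' _; exact.
have m0 : (0 < m)%N by apply: leq_trans (km i0); rewrite absz_gt0.
(* As [2 ^ l <= m < 2 ^ l.+1], the point lies in the ball of index [l.+1], whose weight
   [16 / 16 ^+ l.+1 = (2 ^ l)^-4] is at least [|k|^-4]. *)
pose l := trunc_log 2 m.
have /andP[lm ml] := trunc_log_bounds (isT : (1 < 2)%N) m0.
have lM : (l.+1 < M.+1)%N.
  rewrite ltnS; apply: leq_trans (kM i1); rewrite ltnS -/m.
  by apply: leq_trans lm; apply: ltnW; exact: ltn_expl.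
rewrite (bigD1 (Ordinal lM))//= -[leLHS]addr0 lerD//; last first.
  by apply: sumr_ge0 => l' _; rewrite !mulr_ge0// invr_ge0 exprn_ge0.
have -> : ball_inf (2 ^ l.+1) k.
  by apply/forallP => i; exact: leq_ltn_trans (km i) ml.
rewrite mulr1.
have -> : 16 / 16 ^+ l.+1 = (16 ^+ l)^-1 :> R.
  by rewrite exprS invfM mulrA divff ?mul1r ?pnatr_eq0.
rewrite lef_pV2 ?posrE; last 2 first.
- rewrite exprn_gt0// /sqnorm (bigD1 i1)//=.
  rewrite ltr_wpDr ?sumr_ge0// => [i _|]; first exact: sqr_ge0.
  by rewrite exprn_even_gt0//= intr_eq0 -absz_eq0 -lt0n.
- by rewrite exprn_gt0.
have -> : 16 ^+ l = ((2 ^+ l) ^+ 2) ^+ 2 :> R.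
  rewrite (_ : 16 = 2 ^+ 4 :> R); last by ring.
  by rewrite -!exprM; congr (_ ^+ _); lia.
rewrite ler_pXn2r ?nnegrE ?exprn_ge0//; last by rewrite sumr_ge0// => i _; exact: sqr_ge0.
rewrite /sqnorm (bigD1 i1)//= -[leLHS]addr0 lerD//; last first.
  by rewrite sumr_ge0// => i _; exact: sqr_ge0.
rewrite -[leRHS]real_normK ?num_real// ler_pXn2r ?nnegrE ?exprn_ge0//.
by rewrite -intr_norm -natr_absz -natrX ler_nat.
Qed.

Lemma sum_half_pow_le N : \sum_(l < N) (2 ^+ l)^-1 <= 2 :> R.
Proof.
suff -> : \sum_(l < N) (2 ^+ l)^-1 = 2 - 2 * (2 ^+ N)^-1 :> R.
  by rewrite gerBl mulr_ge0// invr_ge0 exprn_ge0.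
elim: N => [|N IH].
  by rewrite big_ord0 expr0 invr1; lra.
rewrite big_ord_recr/= IH exprS invfM.
have -> : 2 * (2^-1 * (2 ^+ N)^-1) = (2 ^+ N)^-1 :> R by rewrite mulrA divff ?mul1r.
by lra.
Qed.

(** For fixed [J'], the ball of radius [2 ^ l] contains at most [(2 * 2 ^ l) ^ 3 = 8 * 8 ^ l]
    differences, each of weight [16 / 16 ^ l]. Scale [l] thus contributes [128 / 2 ^ l], and all
    scales together at most 256. The dimension enters through [8 < 16]. *)
Lemma lattice_sum_le (M : nat) : (n <= 3)%N -> (0 < M)%N ->
  \sum_(J in @box n (24 * M) M) \sum_(J' in @box n (24 * M) M | J' != J)
    (sqnorm (frequency J - frequency J') ^+ 2)^-1 <= 256 * M%:R ^+ n :> R.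
Proof.
move=> n3 M0; set B := box _.
have BM J J' : J \in B -> J' \in B -> ball_inf M (frequency J - frequency J').
  move=> /forallP h1 /forallP h2; apply/forallP => i; rewrite !ffunE.
  have := h1 i; have := h2 i; lia.
have freq_inj (J J' : {ffun 'I_n -> 'I_(24 * M)}) : J' != J -> frequency J - frequency J' != 0.
  apply: contra; rewrite subr_eq0 => /eqP/ffunP e; apply/eqP/ffunP => i.
  by apply/val_inj; have := e i; rewrite !ffunE => -[].
pose g (l : nat) : R := 16 * (16 ^+ l)^-1.
have g0 l : 0 <= g l by rewrite mulr_ge0// invr_ge0 exprn_ge0.
have inner J' : J' \in B ->
    \sum_(J in B | J != J') (sqnorm (frequency J - frequency J') ^+ 2)^-1 <= 256 :> R.
  move=> BJ'.
  apply: (@le_trans _ _ (\sum_(l < M.+1) g l * (8 * 8 ^+ l))); last first.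
    apply: (@le_trans _ _ (\sum_(l < M.+1) 128 * (2 ^+ l)^-1)).
      apply: ler_sum => l _; rewrite le_eqVlt; apply/orP; left; apply/eqP.
      rewrite /g (_ : 16 = 2 * 8 :> R); last by ring.
      rewrite exprMn.
      have h2 : 2 ^+ l != 0 :> R by rewrite expf_neq0// pnatr_eq0.
      have h8 : 8 ^+ l != 0 :> R by rewrite expf_neq0// pnatr_eq0.
      by field; rewrite h2 h8.
    by rewrite -mulr_sumr; have := sum_half_pow_le M.+1; lra.
  apply: (@le_trans _ _ (\sum_(J in B | J != J') \sum_(l < M.+1)
      g l * (ball_inf (2 ^ l) (frequency J - frequency J'))%:R)).
    apply: ler_sum => J /andP[BJ JJ']; apply: sqnorm_inv_le.
      by apply: freq_inj; rewrite eq_sym.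
    exact: BM.
  rewrite exchange_big/=; apply: ler_sum => l _.
  rewrite -mulr_sumr ler_wpM2l// -natr_sum.
  apply: (@le_trans _ _ ((2 * 2 ^ l) ^ n)%:R).
    rewrite ler_nat; apply: leq_trans (card_ball_inf_le (2 ^ l) J').
    rewrite -sum1_card big_mkcond [leqRHS]big_mkcond/=.
    apply: leq_sum => J _.
    have -> : (J \in [pred J : {ffun 'I_n -> 'I_(24 * M)} |
        ball_inf (2 ^ l) (frequency J - frequency J')%R]) =
        ball_inf (2 ^ l) (frequency J - frequency J')%R by [].
    by case: ifP => // _; case: (ball_inf _ _).
  apply: (@le_trans _ _ ((2 * 2 ^ l) ^ 3)%:R).
    by rewrite ler_nat leq_pexp2l// muln_gt0/= expn_gt0.
  rewrite -natrX -natrM ler_nat.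
  by have -> : ((2 * 2 ^ l) ^ 3 = 8 * 8 ^ l)%N by rewrite expnMn -expnM (mulnC l) expnM.
rewrite (exchange_big_dep (mem B))/=; last by move=> J J' _ /andP[].
apply: (@le_trans _ _ (\sum_(J' in B) 256)).
  apply: ler_sum => J' BJ'; apply: le_trans (inner J' BJ').
  rewrite le_eqVlt; apply/orP; left; apply/eqP; apply: eq_bigl => J.
  by rewrite BJ'/= eq_sym.
rewrite sumr_const card_box; last by lia.
by rewrite -[_ *+ (M ^ n)%N]mulr_natr natrX.
Qed.

End lattice_sums.

(** * Bounds for integrals of arbitrary functions *)

Section nonmeasurable_bound.
Context {d : measure_display} {T : measurableType d} {R : realType}.
Variable mu : {measure set T -> \bar R}.
Local Open Scope ereal_scope.

(** The integral of a nonnegative function is a supremum over the simple functions below it, hence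
    monotone whether or not the function is measurable. The iterated integrals in [mp_bracket] can
    thus be bounded directly. *)
Lemma ge0_subset_integral_le (f g : T -> \bar R) :
  (forall x, 0 <= f x) -> (forall x, f x <= g x) ->
  \int[mu]_x f x <= \int[mu]_x g x.
Proof.
move=> f0 fg; have g0 x : 0 <= g x by exact: le_trans (fg x).
rewrite !ge0_integralTE//; apply: ereal_sup_le => _ [h /= hf <-].
by exists h => // x; exact: le_trans (fg x).
Qed.

End nonmeasurable_bound.

(** The positive and the negative part both integrate to a number in [[0, c * mu D]], so their
    difference obeys the same bound. *)
Lemma normr_Rintegral_le_cst (d : measure_display) (T : measurableType d)
    (R : realType) (mu : {measure set T -> \bar R}) (D : set T) (f : T -> R)
    (c : R) :
  measurable D -> (mu D < +oo)%E -> (forall x, D x -> `|f x| <= c) -> 0 <= c ->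
  `|\int[mu]_(x in D) f x| <= c * fine (mu D).
Proof.
move=> mD Doo fc c0; rewrite /Rintegral.
rewrite integral_mkcond integralE.
set g := _ \_ D.
have bound (h : T -> \bar R) : (forall x, (0 <= h x)%E) ->
    (forall x, (h x <= (cst c%:E \_ D) x)%E) ->
    exists2 r : R, (0 <= r <= c * fine (mu D))%R & (\int[mu]_x h x = r%:E)%E.
  move=> h0 hc.
  have le1 : (\int[mu]_x h x <= (c * fine (mu D))%:E)%E.
    apply: le_trans (ge0_subset_integral_le mu h0 hc) _.
    rewrite -integral_mkcond integral_cst// EFinM fineK//.
    by rewrite ge0_fin_numE.
  have ge1 : (0 <= \int[mu]_x h x)%E by apply: integral_ge0.
  exists (fine (\int[mu]_x h x)%E); last first.
    by rewrite fineK// ge0_fin_numE//; apply: le_lt_trans le1 (ltry _).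
  rewrite fine_ge0//= -lee_fin fineK//.
  by rewrite ge0_fin_numE//; apply: le_lt_trans le1 (ltry _).
have gc x : (`|g x| <= (cst c%:E \_ D) x)%E.
  by rewrite /g !patchE; case: ifPn => [/set_mem/fc|_]; rewrite ?abse0//= lee_fin.
have absg x : (`|g x| = g^\+ x + g^\- x)%E.
  by have := congr1 (@^~ x) (fune_abse g).
have [|x|a /andP[a0 ac] ->] := bound (g ^\+)%E.
- by move=> x; rewrite funepos_ge0.
- by apply: le_trans (gc x); rewrite absg leeDl// funeneg_ge0.
have [|x|b /andP[b0 bc] ->] := bound (g ^\-)%E.
- by move=> x; rewrite funeneg_ge0.
- by apply: le_trans (gc x); rewrite absg leeDr// funepos_ge0.
rewrite -EFinB/= ler_norml; apply/andP; split; lra.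
Qed.

(** * The occupation measure as a composition of kernels *)

Section constant_kernel.
Context {d d' : measure_display} {X : measurableType d} {Y : measurableType d'}
  {R : realType}.

Definition kcst (m : {measure set Y -> \bar R}) (_ : X) : {measure set Y -> \bar R} := m.

Let measurable_kcst m U : measurable U -> measurable_fun setT (kcst m ^~ U).
Proof. by move=> _; exact: measurable_cst. Qed.

HB.instance Definition _ m := isKernel.Build _ _ X Y R (kcst m) (@measurable_kcst m).

Variable m : {sigma_finite_measure set Y -> \bar R}.

(** A second name for [kcst m], to carry the s-finite structure that a sigma-finite [m] provides. *)
Definition kcst_sigma_finite : X -> {measure set Y -> \bar R} := kcst m.

HB.instance Definition _ := Kernel.on kcst_sigma_finite.

Let sfinite_kcst : exists2 k_ : (R.-ker X ~> Y)^nat, forall n, measure_fam_uub (k_ n) &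
  forall x U, measurable U -> kcst_sigma_finite x U = mseries (k_ ^~ x) 0 U.
Proof.
exists (fun n => kcst (sfinite_measure_seq m n)).
  move=> n; exists (fine (sfinite_measure_seq m n setT) + 1) => x.
  by rewrite /kcst EFinD fineK ?fin_num_measure// lteDl ?lte_fin// fin_num_measure.
by move=> x U mU; exact: sfinite_measure_seqP.
Qed.

HB.instance Definition _ :=
  isSFiniteKernel_subdef.Build _ _ X Y R kcst_sigma_finite sfinite_kcst.

End constant_kernel.

Section time_average.
Context {R : realType} {n : nat}.
Variables (nu : R -> MF R n) (T K : R).
Hypothesis mnu : forall B, measurable B ->
  measurable_fun (`[0, +oo[ : set R) (fun s => nu s B : \bar R).
Hypothesis nuK : forall s, 0 <= s <= T -> (nu s setT <= K%:E)%E.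

(** Composing it with Lebesgue measure yields [Y_T] as a measure, and Tonelli's theorem for it is
    then [integral_kcomp]. Composition dictates the argument in [unit * R]; the value zero off
    [[0, T]] makes the kernel finite and measurable on the whole line. *)
Definition path_kernel (p : unit * measurableTypeR R) : {measure set 'rV[R]_n -> \bar R} :=
  if 0 <= p.2 <= T then nu p.2 else mzero.

Lemma path_kernelE p B : path_kernel p B = ((fun s => nu s B) \_ `[0, T]) p.2.
Proof.
rewrite /path_kernel patchE mem_setE in_itv/=; by case: ifP.
Qed.

Let measurable_path_kernel U : measurable U -> measurable_fun setT (path_kernel ^~ U).
Proof.
move=> mU.
have -> : path_kernel ^~ U = ((fun s => nu s U) \_ `[0, T]) \o snd.
  by apply/funext => p; rewrite path_kernelE.
apply: measurableT_comp => //.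
apply/(measurable_restrictT _ (measurable_itv `[0, T])).
apply: (measurable_funS (measurable_itv `[0, +oo[)); last exact: mnu.
by move=> s /=; rewrite !in_itv/= => /andP[->].
Qed.

HB.instance Definition _ := isKernel.Build _ _ _ _ R path_kernel measurable_path_kernel.

Let path_kernel_uub : measure_fam_uub path_kernel.
Proof.
exists (`|K| + 1) => -[[] s]; rewrite /path_kernel; case: ifP => h; last first.
  by rewrite /mzero lte_fin ltr_wpDl.
by apply: le_lt_trans (nuK h) _; rewrite lte_fin ltr_pwDr// ler_norm.
Qed.

HB.instance Definition _ := Kernel_isFinite.Build _ _ _ _ R path_kernel path_kernel_uub.

Definition path_sfkernel : R.-sfker (unit * measurableTypeR R) ~> 'rV[R]_n := path_kernel.

Definition lebesgue_sfkernel : R.-sfker unit ~> measurableTypeR R :=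
  kcst_sigma_finite (@lebesgue_measure R).

Lemma integral_time_average (f : 'rV[R]_n -> \bar R) :
  (forall x, (0 <= f x)%E) -> measurable_fun setT f ->
  (\int[kcomp lebesgue_sfkernel path_sfkernel tt]_x f x =
   \int[lebesgue_measure]_(s in `[0%R, T]) \int[nu s]_x f x)%E.
Proof.
move=> f0 mf; have e := integral_kcomp lebesgue_sfkernel path_sfkernel tt f0 mf.
apply: (etrans e); rewrite [RHS]integral_mkcond.
apply: eq_integral => s _; rewrite patchE mem_setE in_itv/= /path_kernel/=.
by case: ifP => // _; rewrite integral_measure_zero.
Qed.

Lemma measurable_integral_path (f : 'rV[R]_n -> \bar R) :
  (forall x, (0 <= f x)%E) -> measurable_fun setT f ->
  measurable_fun (`[0, T] : set (measurableTypeR R))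
    (fun s => \int[nu s]_x f x : \bar R)%E.
Proof.
move=> f0 mf.
have mk U : measurable U ->
    measurable_fun setT (fun s : measurableTypeR R => path_kernel (tt, s) U).
  move=> mU; apply: measurableT_comp (measurable_path_kernel mU) _.
  exact: measurable_fun_pair.
have h := measurable_fun_integral_kernel mk f0 mf.
apply: (eq_measurable_fun (fun s : measurableTypeR R => \int[path_kernel (tt, s)]_x f x)%E).
  move=> s /set_mem sI; have /itvP hs : (s : R) \in `[0, T] by exact: sI.
by rewrite /path_kernel/= !hs.
exact: (measurable_funS measurableT).
Qed.

Definition time_average : {measure set 'rV[R]_n -> \bar R} :=
  kcomp lebesgue_sfkernel path_sfkernel tt.

Lemma time_averageE B : time_average B =
  (\int[lebesgue_measure]_(s in `[0%R, T]) nu s B)%E.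
Proof.
rewrite [RHS]integral_mkcond; apply: eq_integral => s _.
exact: (path_kernelE (tt, s) B).
Qed.

Let I := (`[0, T]%classic : set (measurableTypeR R)).

Let lebT : (lebesgue_measure I < +oo)%E.
Proof. by rewrite /I lebesgue_measure_itv/=; case: ifP => _; rewrite -?EFinB ltry. Qed.

Let mI : measurable I. Proof. exact: measurable_itv. Qed.

Lemma measurable_path B : measurable B ->
  measurable_fun I (fun s => nu s B : \bar R).
Proof.
move=> mB; apply: (measurable_funS (measurable_itv `[0, +oo[)); last exact: mnu.
move=> s sI; have /itvP hs : (s : R) \in `[0, T] by exact: sI.
by have : (s : R) \in `[0, +oo[ by rewrite in_itv/= hs.
Qed.

Let time_average_finite : fin_num_fun time_average.
Proof.
apply: lty_fin_num_fun; rewrite time_averageE.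
apply: (@le_lt_trans _ _ (\int[lebesgue_measure]_(s in I) (cst `|K|%:E s))%E).
  apply: ge0_le_integral => //.
  - exact: measurable_path.
  - move=> s sI; apply: le_trans (nuK _) _; last by rewrite lee_fin ler_norm.
    by move: (sI : (s : R) \in `[0, T]); rewrite in_itv.
by rewrite integral_cst//; apply: lte_mul_pinfty; rewrite ?lee_fin.
Qed.

Let Y : MF R n := HB.pack_for (MF R n) (Measure.sort time_average)
  (Measure.class time_average)
  (Measure_isFinite.Build _ _ _ (Measure.sort time_average) time_average_finite).

Let time_average_ge0 (p : 'rV[R]_n -> R) (c : R) :
  measurable_fun setT p -> (forall x, 0 <= p x <= c) ->
  lebesgue_measure.-integrable I (EFin \o (fun s => pairing (nu s) p)) /\
  pairing Y p = \int[lebesgue_measure]_(s in I) pairing (nu s) p.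
Proof.
move=> mp pc.
have p0 x : (0 <= (p x)%:E)%E by rewrite lee_fin; case/andP: (pc x).
have mp' : measurable_fun setT (EFin \o p) by exact/measurable_EFinP.
have ip (m : MF R n) : m.-integrable setT (EFin \o p).
  apply: measurable_bounded_integrable => //.
    by rewrite ltey_eq fin_num_measure.
  by apply: (@bounded_fun_le _ _ _ c) => x; case/andP: (pc x) => ? ?; rewrite ger0_norm.
have fe s : (pairing (nu s) p)%:E = (\int[nu s]_x (p x)%:E)%E.
  by rewrite /pairing /Rintegral fineK// integrable_fin_num//; exact: ip.
have mpair : measurable_fun I (fun s => pairing (nu s) p).
  apply/measurable_EFinP.
  rewrite (_ : EFin \o _ = (fun s => \int[nu s]_x (p x)%:E)%E); last first.
    by apply/funext => s /=; rewrite fe.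
  exact: measurable_integral_path.
have c0 : 0 <= c by case/andP: (pc 0); exact: le_trans.
split.
  apply: measurable_bounded_integrable => //.
  exists (c * K); split; first exact: num_real.
  move=> y cy s Is; apply: le_trans (ltW cy).
  have nus : (nu s setT < +oo)%E by rewrite ltey_eq fin_num_measure.
  apply: le_trans (normr_Rintegral_le_cst measurableT nus _ c0) _ => /=.
    by move=> x _; case/andP: (pc x) => ? ?; rewrite ger0_norm.
  rewrite ler_wpM2l// -lee_fin fineK ?fin_num_measure//.
  by apply: nuK; move: (Is : (s : R) \in `[0, T]); rewrite in_itv.
rewrite /pairing {1}/Rintegral.
have -> : (\int[Y]_x (p x)%:E = \int[lebesgue_measure]_(s in I) (pairing (nu s) p)%:E)%E.
  rewrite [LHS]integral_time_average//.
  by apply: eq_integral => s _; rewrite fe.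
by [].
Qed.

Lemma exists_time_average : exists Z : MF R n,
  (forall B, Z B = \int[lebesgue_measure]_(s in `[0%R, T]) nu s B)%E /\
  (forall phi, Cb phi ->
    lebesgue_measure.-integrable `[0, T] (EFin \o (fun s => pairing (nu s) phi)) /\
    pairing Z phi = \int[lebesgue_measure]_(s in `[0, T]) pairing (nu s) phi).
Proof.
exists Y; split; first exact: time_averageE.
move=> phi Cphi; have [cphi [c0 [_ hc0]]] := Cphi.
pose c := `|c0| + 1.
have hc x : `|phi x| <= c by apply: (hc0 c) => //; rewrite ltr_pwDr// ler_norm.
(* Tonelli's formula concerns nonnegative functions, hence the splitting into positive and negative
   parts. *)
pose p x := Num.max (phi x) 0; pose q x := Num.max (- phi x) 0.
have mphi := continuous_measurable_rV cphi.
have mp : measurable_fun setT p by exact: measurable_maxr.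
have mq : measurable_fun setT q by apply: measurable_maxr => //; exact: measurableT_comp.
have pc x : 0 <= p x <= c.
  rewrite /p le_max lexx orbT ge_max (le_trans _ (hc x)) ?ler_norm//=.
  by rewrite (le_trans _ (hc x)).
have qc x : 0 <= q x <= c.
  rewrite /q le_max lexx orbT ge_max (le_trans (normr_ge0 _) (hc x)) !andbT.
  by rewrite (le_trans _ (hc x))// -normrN ler_norm.
have phiE : phi = fun x => p x - q x.
  apply/funext => x; rewrite /p /q; case: (leP (phi x) 0) => h.
    by rewrite max_l ?oppr_ge0// sub0r opprK.
  by rewrite max_r ?subr0// oppr_le0 ltW.
have bi (f : 'rV[R]_n -> R) (m : MF R n) : measurable_fun setT f ->
    (forall x, 0 <= f x <= c) -> m.-integrable setT (EFin \o f).
  move=> mf fc; apply: measurable_bounded_integrable => //.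
    by rewrite ltey_eq fin_num_measure.
  by apply: (@bounded_fun_le _ _ _ c) => x; case/andP: (fc x) => ? ?; rewrite ger0_norm.
have pairE (m : MF R n) : pairing m phi = pairing m p - pairing m q.
  by rewrite phiE /pairing RintegralB//; exact: bi.
have [ip eY] := time_average_ge0 mp pc.
have [iq eYq] := time_average_ge0 mq qc.
split; last first.
  rewrite pairE eY eYq -RintegralB//.
  by apply: eq_Rintegral => s _; rewrite pairE.
rewrite (_ : EFin \o _ = ((EFin \o (fun s => pairing (nu s) p)) \-
    (EFin \o (fun s => pairing (nu s) q)))%E); first exact: integrableB.
by apply/funext => s /=; rewrite pairE EFinB.
Qed.

End time_average.

(** * Plane waves as test functions *)

Section waves.
Context {R : realType} {n : nat}.
Implicit Types (k : {ffun 'I_n -> int}) (c a : R) (x v : 'rV[R]_n).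

(** Amplitude and shift make the family closed under partial derivatives, which multiply [c] and add
    [pi / 2] to [a]. It also contains the sines and the constants. *)
Definition wave c k a : 'rV[R]_n -> R := fun x => c * cos (phase k x + a).

Lemma Cb_wave c k a : Cb (wave c k a).
Proof.
split; last first.
  by apply: (@bounded_fun_le _ _ _ `|c|) => x; rewrite normrM ler_piMr// cos_max.
have cp : continuous (fun x => phase k x + a : R).
  by move=> x; exact: (cvgD (@continuous_phase R n k x) (cvg_cst a)).
have cc : continuous (fun x => cos (phase k x + a) : R).
  by move=> x; exact: (continuous_comp (cp x) (@continuous_cos _ _)).
by move=> x; exact: (continuous_comp (cc x) (@mulrl_continuous _ _ _)).
Qed.

Lemma phaseDZ k x v (h : R) : phase k (h *: v + x) = h * phase k v + phase k x :> R.
Proof.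
rewrite /phase.
have -> : \sum_i (k i)%:~R * (h *: v + x) ord0 i =
    h * (\sum_i (k i)%:~R * v ord0 i) + \sum_i (k i)%:~R * x ord0 i.
  rewrite mulr_sumr -big_split; apply: eq_bigr => i _ /=.
  by rewrite !mxE; ring.
ring.
Qed.

Lemma phase_delta k i : phase k (delta_mx ord0 i) = 2 * pi * (k i)%:~R :> R.
Proof.
rewrite /phase (bigD1 i)//= big1 ?addr0; first by rewrite mxE !eqxx mulr1.
by move=> j ji; rewrite mxE (negbTE ji) andbF mulr0.
Qed.

Lemma is_derive_wave c k a x v :
  is_derive x v (wave c k a) (wave (c * phase k v) k (a + pi / 2) x).
Proof.
(* The wave along the line [x + h v], which reduces the claim to one variable. *)
pose g h : R := c * cos (h * phase k v + (phase k x + a)).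
have dg : is_derive (0 : R) 1 g (wave (c * phase k v) k (a + pi / 2) x).
  have dl : is_derive (0 : R) 1 (fun h => h * phase k v + (phase k x + a)) (phase k v).
    apply: is_derive_eq; rewrite scaler0 add0r addr0.
    by rewrite -[RHS]mulr1.
  have dcos : is_derive (0 : R) 1 (fun h => cos (h * phase k v + (phase k x + a)))
     (- sin (phase k x + a) * phase k v).
    have := @is_derive1_comp R cos (fun h => h * phase k v + (phase k x + a)) 0 _ _ _ dl.
    by move=> h; apply: (is_derive_eq (h _ _)); rewrite mul0r add0r.
  apply: is_derive_eq.
  rewrite /wave addrA cosDpihalf /GRing.scale/=; ring.
have e : (fun h : R => h^-1 *: ((wave c k a \o shift x) (h *: v) - wave c k a x)) =
    (fun h : R => h^-1 *: ((g \o shift 0) (h *: 1) - g 0)).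
  apply/funext => h; congr (_ *: (_ - _)); rewrite /= /wave /g.
    by rewrite phaseDZ addr0 [_ *: 1]mulr1 addrA.
  by rewrite mul0r add0r.
have [d1 d2] := dg; split.
  by rewrite /derivable e; exact: d1.
by rewrite /derive e; exact: d2.
Qed.

Lemma has_partial_wave c k a i : has_partial i (wave c k a).
Proof. by move=> x; have [] := is_derive_wave c k a x (delta_mx ord0 i). Qed.

Lemma partial_wave c k a i :
  partial i (wave c k a) = wave (c * (2 * pi * (k i)%:~R)) k (a + pi / 2).
Proof.
apply/funext => x; rewrite /partial -phase_delta.
by have [_ ->] := is_derive_wave c k a x (delta_mx ord0 i).
Qed.

Lemma Cb2_wave c k a : Cb2 (wave c k a).
Proof.
split; first exact: Cb_wave.
- by move=> i; rewrite partial_wave; split; [exact: has_partial_wave|exact: Cb_wave].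
- move=> i j; rewrite !partial_wave; split; last exact: Cb_wave.
  exact: has_partial_wave.
Qed.

Lemma laplacian_wave c k a x :
  laplacian (wave c k a) x = - (4 * pi ^+ 2 * sqnorm k) * wave c k a x.
Proof.
rewrite /laplacian /sqnorm mulr_sumr -sumrN mulr_suml; apply: eq_bigr => i _.
rewrite !partial_wave /wave -addrA -splitr addrA cosDpi; ring.
Qed.

End waves.

(** * Averages over pairs of frequencies, with random coefficients *)

Lemma measurable_sum_cond (d : measure_display) (T : measurableType d)
    (R : realType) (D : set T) (I : Type) (s : seq I) (p : pred I)
    (h : I -> T -> R) : (forall i, measurable_fun D (h i)) ->
  measurable_fun D (fun x => \sum_(i <- s | p i) h i x).
Proof.
move=> mh; rewrite (_ : (fun x => _) = fun x => \sum_(i <- [seq i <- s | p i]) h i x).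
  exact: measurable_sum.
by apply/funext => x; rewrite big_filter.
Qed.

Lemma ge0_integral_sum_le (d : measure_display) (T : measurableType d)
    (R : realType) (mu : {measure set T -> \bar R}) (I : Type) (s : seq I)
    (p : pred I) (f : I -> T -> R) (c : I -> R) :
  (forall i, measurable_fun setT (f i)) -> (forall i x, 0 <= f i x) ->
  (forall i, p i -> (\int[mu]_x (f i x)%:E <= (c i)%:E)%E) ->
  (\int[mu]_x (\sum_(i <- s | p i) f i x)%:E <= (\sum_(i <- s | p i) c i)%:E)%E.
Proof.
move=> mf f0 fc.
under eq_integral do rewrite -sumEFin -big_filter.
rewrite ge0_integral_sum//; last 2 first.
- by move=> i; exact/measurable_EFinP.
- by move=> i x _; rewrite lee_fin.
by rewrite big_filter -sumEFin; exact: lee_sum.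
Qed.

Section lattice_average.
Context {R : realType} {n : nat}.

(** Separates the deterministic decay [|k|^-4] from the factor [s], which will be random and bounded
    in mean. The frequency 0, where there is no decay, is left out. *)
Definition lattice_average (s : {ffun 'I_n -> int} -> R) (M : nat) : R :=
  (M%:R ^+ n)^-1 * \sum_(J in @box n (24 * M) M)
    \sum_(J' in @box n (24 * M) M | J' != J)
      (sqnorm (frequency J - frequency J') ^+ 2)^-1 *
        s (frequency J - frequency J').

Lemma lattice_averageD (s t : {ffun 'I_n -> int} -> R) (M : nat) :
  lattice_average (fun k => s k + t k) M =
  lattice_average s M + lattice_average t M.
Proof.
rewrite /lattice_average -mulrDr -big_split/=; congr (_ * _).
apply: eq_bigr => J _; rewrite -big_split; apply: eq_bigr => J' _.
by rewrite mulrDr.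
Qed.

Lemma lattice_averageZ (c : R) (s : {ffun 'I_n -> int} -> R) (M : nat) :
  lattice_average (fun k => c * s k) M = c * lattice_average s M.
Proof.
rewrite /lattice_average mulrCA; congr (_ * _); rewrite mulr_sumr.
apply: eq_bigr => J _; rewrite mulr_sumr; apply: eq_bigr => J' _.
by rewrite mulrCA.
Qed.

Lemma lattice_average1_le (M : nat) : (n <= 3)%N -> (0 < M)%N ->
  lattice_average (fun=> 1) M <= 256.
Proof.
move=> n3 M0; rewrite /lattice_average.
have Mn : 0 < M%:R ^+ n :> R by rewrite exprn_gt0// ltr0n.
rewrite ler_pdivrMl// mulrC; under eq_bigr do under eq_bigr do rewrite mulr1.
exact: lattice_sum_le.
Qed.

(** The averages have mean at most [256 * C], so by Fatou's lemma their lower limit is integrable,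
    hence finite almost surely. Infinitely many of them lie below the lower limit plus 1; which ones
    depends on [w]. *)
Lemma ae_lattice_average_frequently (d : measure_display)
    (T : measurableType d) (P : probability T R)
    (S : {ffun 'I_n -> int} -> T -> R) (C : R) :
  (n <= 3)%N -> 0 <= C -> (forall k, measurable_fun setT (S k)) ->
  (forall k w, 0 <= S k w) ->
  (forall k, k != 0 -> (\int[P]_w (S k w)%:E <= C%:E)%E) ->
  {ae P, forall w, exists c : R, forall N, exists2 M, (N < M)%N &
    lattice_average (S ^~ w) M <= c}.
Proof.
move=> n3 C0 mS S0 SC.
have w0 (k : {ffun 'I_n -> int}) : 0 <= (sqnorm k ^+ 2)^-1 :> R.
  by rewrite invr_ge0 exprn_ge0// sumr_ge0// => i _; exact: sqr_ge0.
pose q M w := lattice_average (S ^~ w) M.+1.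
have q0 M w : 0 <= q M w.
  rewrite mulr_ge0 ?invr_ge0 ?exprn_ge0// sumr_ge0// => J _.
  by rewrite sumr_ge0// => J' _; rewrite mulr_ge0.
have mq M : measurable_fun setT (q M).
  apply: measurable_funM => //; apply: measurable_sum_cond => J; apply: measurable_sum_cond => J'.
  exact: measurable_funM.
have qC M : (\int[P]_w (q M w)%:E <= (256 * C)%:E)%E.
  have Mn : 0 < M.+1%:R ^+ n :> R by rewrite exprn_gt0// ltr0n.
  under eq_integral do rewrite /q /lattice_average EFinM.
  rewrite ge0_integralZl_EFin//; last 2 first.
  - by move=> w _; rewrite lee_fin sumr_ge0// => J _; rewrite sumr_ge0// => J' _; rewrite mulr_ge0.
  - apply/measurable_EFinP; apply: measurable_sum_cond => J; apply: measurable_sum_cond => J'.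
    exact: measurable_funM.
  rewrite lee_pdivrMl// -EFinM.
  apply: (@le_trans _ _ (\sum_(J in @box n (24 * M.+1) M.+1)
      \sum_(J' in @box n (24 * M.+1) M.+1 | J' != J)
      ((sqnorm (frequency J - frequency J') ^+ 2)^-1 * C))%:E).
    apply: ge0_integral_sum_le => [J|J w|J _].
    + by apply: measurable_sum_cond => J'; exact: measurable_funM.
    + by rewrite sumr_ge0// => J' _; rewrite mulr_ge0.
    apply: ge0_integral_sum_le => [J'|J' w|J' /andP[_ J'J]].
    + exact: measurable_funM.
    + by rewrite mulr_ge0.
    under eq_integral do rewrite EFinM.
    rewrite ge0_integralZl_EFin//; last 2 first.
    + by move=> w _; rewrite lee_fin.
    + exact/measurable_EFinP.
    rewrite EFinM lee_wpmul2l ?lee_fin//; apply: SC.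
    apply: contra J'J; rewrite subr_eq0 => /eqP/ffunP e; apply/eqP/ffunP => i.
    by apply/val_inj; have := e i; rewrite !ffunE => -[].
  rewrite lee_fin; under eq_bigr do rewrite -mulr_suml.
  rewrite -mulr_suml mulrA ler_wpM2r// 1?mulrC; last exact: lattice_sum_le.
have mq' : measurable_fun setT (fun w => limn_einf (fun M => (q M w)%:E)).
  by apply: measurable_fun_limn_einf => M; exact/measurable_EFinP.
have lq0 w : (0 <= limn_einf (fun M => (q M w)%:E))%E.
  by apply: le_limn_einf; apply: nearW => M; rewrite lee_fin.
have iq : P.-integrable setT (fun w => limn_einf (fun M => (q M w)%:E)).
  apply/integrableP; split => //.
  under eq_integral do rewrite gee0_abs//.
  apply: le_lt_trans (_ : ((256 * C)%:E < +oo)%E); last exact: ltry.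
  apply: le_trans (limn_einf_le qC); apply: fatou => //.
    by move=> M; exact/measurable_EFinP.
  by move=> M w _; rewrite lee_fin.
have := integrable_ae measurableT iq; apply: filterS => w /(_ I) fw.
exists (fine (limn_einf (fun M => (q M w)%:E)) + 1) => N.
have [|M NM h] := @limn_einf_lt_frequently _ (fun M => (q M w)%:E)
    (fine (limn_einf (fun M => (q M w)%:E)) + 1)%:E _ N.
  by rewrite EFinD fineK// lteDl// lte_fin.
by exists M.+1 => //; apply/ltW; rewrite -lte_fin.
Qed.

End lattice_average.

(** * Pathwise estimates from the martingale problem *)

Section superprocess_waves.
Context {R : realType} {n : nat} {d : measure_display} {Omega : measurableType d}.
Implicit Types (nu : MF R n) (X : R -> Omega -> MF R n)
  (g : 'rV[R]_n -> 'rV[R]_n -> R) (phi : 'rV[R]_n -> R).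

Lemma normr_pairing_le nu phi (c : R) : (forall x, `|phi x| <= c) -> 0 <= c ->
  `|pairing nu phi| <= c * fine (nu setT).
Proof.
move=> phic c0; apply: normr_Rintegral_le_cst => //.
by rewrite ltey_eq fin_num_measure.
Qed.

Lemma wave0 c : wave c 0 0 = cst c :> ('rV[R]_n -> R).
Proof.
apply/funext => x; rewrite /wave /phase big1 => [|i _]; last by rewrite ffunE mul0r.
by rewrite mulr0 addr0 cos0 mulr1.
Qed.

Lemma sqnorm0 : sqnorm (0 : {ffun 'I_n -> int}) = 0 :> R.
Proof. by rewrite /sqnorm big1// => i _; rewrite ffunE expr0n. Qed.

Lemma sqnorm_gt0 (k : {ffun 'I_n -> int}) : k != 0 -> 0 < sqnorm k :> R.
Proof.
move=> k0; rewrite lt_def sumr_ge0 ?andbT; last by move=> i _; exact: sqr_ge0.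
apply: contra k0; rewrite psumr_eq0 => [/allP h|i _]; last exact: sqr_ge0.
apply/eqP/ffunP => i; rewrite ffunE; apply/eqP.
by have := h i (mem_index_enum i); rewrite sqrf_eq0 intr_eq0.
Qed.

Lemma pairing_cst nu (c : R) : pairing nu (cst c) = c * fine (nu setT).
Proof. by rewrite /pairing Rintegral_cst. Qed.

Lemma mp_martingale0 X phi w : mp_martingale X phi 0 w = 0.
Proof. by rewrite /mp_martingale set_itv1 Rintegral_set1 subrr subr0. Qed.

(** The bound involves [phi] only through [|phi| <= 1]: it is the same for all frequencies. *)
Lemma mp_bracket_le g X phi w (T K C : R) : 0 <= T -> 0 <= K -> 0 <= C ->
  (forall x y, `|g x y| <= C) -> (forall x, `|phi x| <= 1) ->
  (forall s : R, 0 <= s <= T -> (X s w setT <= K%:E)%E) ->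
  mp_bracket g X phi T w <= K * T + C * K * K * T.
Proof.
move=> T0 K0 C0 gC phi1 XK.
have XK' s : 0 <= s <= T -> fine (X s w setT) <= K.
  by move=> /XK; rewrite -lee_fin fineK ?fin_num_measure.
have TE : fine (lebesgue_measure (`[0, T] : set R)) = T.
  rewrite lebesgue_measure_itv/= lte_fin; case: ltP => h; first by rewrite -EFinB/= subr0.
  by apply/esym/le_anti; rewrite h T0.
have Too : (lebesgue_measure (`[0%R, T] : set R) < +oo)%E.
  by rewrite lebesgue_measure_itv/=; case: ifP => _; rewrite -?EFinB ltry.
have mI : measurable (`[0, T] : set R) by exact: measurable_itv.
have phi2 x : `|phi x ^+ 2| <= 1 by rewrite normrX expr_le1.
apply: lerD; apply: le_trans (ler_norm _) _; rewrite -[X in _ <= _ * X]TE.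
  apply: (normr_Rintegral_le_cst (c := K)) => // s; rewrite /= in_itv/= => sT.
  apply: le_trans (normr_pairing_le _ phi2 ler01) _; rewrite mul1r.
  exact: XK'.
apply: normr_Rintegral_le_cst => //; last by rewrite !mulr_ge0.
move=> s; rewrite /= in_itv/= => sT.
apply: (@le_trans _ _ (C * K * fine (X s w setT))); last first.
  by rewrite ler_wpM2l ?mulr_ge0// XK'.
apply: normr_pairing_le; last by rewrite mulr_ge0.
move=> u; apply: (@le_trans _ _ (C * fine (X s w setT))); last first.
  by rewrite ler_wpM2l// XK'.
apply: normr_pairing_le => // v; rewrite !normrM.
rewrite -[leRHS]mulr1 ler_pM ?mulr_ge0// -[leRHS]mulr1 ler_pM//.
Qed.

(* The martingale problem, tested with an eigenfunction of the Laplacian. *)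
Lemma pairing_time_average_wave X w (T c a : R) (k : {ffun 'I_n -> int})
    (Z : MF R n) : k != 0 ->
  lebesgue_measure.-integrable `[0, T]
    (EFin \o (fun s => pairing (X s w) (wave c k a))) ->
  pairing Z (wave c k a) =
    \int[lebesgue_measure]_(s in `[0, T]) pairing (X s w) (wave c k a) ->
  2 * pi ^+ 2 * sqnorm k * pairing Z (wave c k a) =
    mp_martingale X (wave c k a) T w + pairing (X 0 w) (wave c k a)
      - pairing (X T w) (wave c k a).
Proof.
move=> k0 iX ->; rewrite /mp_martingale.
have -> : \int[lebesgue_measure]_(s in `[0, T])
    pairing (X s w) (fun x => laplacian (wave c k a) x / 2) =
    - (2 * pi ^+ 2 * sqnorm k) *
      \int[lebesgue_measure]_(s in `[0, T]) pairing (X s w) (wave c k a).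
  rewrite -RintegralZl//.
  apply: eq_Rintegral => s _; rewrite /pairing -RintegralZl//; last first.
    exact: integrable_Cb (Cb_wave c k a).
  by apply: eq_Rintegral => x _; rewrite laplacian_wave; field.
by ring.
Qed.

(** The square of [m + u - v] is at most [3 * (m ^+ 2 + u ^+ 2 + v ^+ 2)], where the two boundary
    terms [u], [v] are at most [K] in absolute value; the factor [2 * pi ^+ 2 >= 1] is dropped. *)
Lemma sqr_pairing_wave_le X w (T c a K : R) (k : {ffun 'I_n -> int})
    (Z : MF R n) : k != 0 -> `|c| <= 1 ->
  (X 0%R w setT <= K%:E)%E -> (X T w setT <= K%:E)%E ->
  lebesgue_measure.-integrable `[0, T]
    (EFin \o (fun s => pairing (X s w) (wave c k a))) ->
  pairing Z (wave c k a) =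
    \int[lebesgue_measure]_(s in `[0, T]) pairing (X s w) (wave c k a) ->
  pairing Z (wave c k a) ^+ 2 <= (sqnorm k ^+ 2)^-1 *
    (3 * mp_martingale X (wave c k a) T w ^+ 2 + 6 * K ^+ 2).
Proof.
move=> k0 c1 K0 KT iX Ze.
have e := pairing_time_average_wave k0 iX Ze.
have wave1 x : `|wave c k a x| <= 1.
  by rewrite normrM -[leRHS]mulr1 ler_pM// cos_max.
have hK t : (X t w setT <= K%:E)%E -> `|pairing (X t w) (wave c k a)| <= K.
  move=> h; apply: le_trans (normr_pairing_le _ wave1 ler01) _.
  by rewrite mul1r -lee_fin fineK// fin_num_measure.
have := hK _ K0; have := hK _ KT; move: e.
set y := pairing Z _; set m := mp_martingale _ _ _ _.
set u := pairing (X 0 w) _; set v := pairing (X T w) _ => e hv hu.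
have sq (t : R) : `|t| <= K -> t ^+ 2 <= K ^+ 2.
  by move=> h; rewrite -[leLHS]real_normK ?num_real// ler_pXn2r ?nnegrE// (le_trans _ h).
have hu2 := sq _ hu; have hv2 := sq _ hv.
have k2 : 0 < sqnorm k ^+ 2 :> R by rewrite exprn_gt0// sqnorm_gt0.
rewrite ler_pdivlMl//.
have pi1 : 1 <= 2 * pi ^+ 2 :> R.
  have := @pi_ge2 R => p2; have : 2 ^+ 2 <= pi ^+ 2 :> R by rewrite ler_pXn2r ?nnegrE// pi_ge0.
  rewrite -natrX; lra.
have : (sqnorm k * y) ^+ 2 <= (m + u - v) ^+ 2.
  have -> : m + u - v = 2 * pi ^+ 2 * (sqnorm k * y) by rewrite -e -mulrA.
  by rewrite [leRHS]exprMn ler_peMl ?sqr_ge0// exprn_ege1.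
rewrite exprMn => /le_trans; apply.
have := sqr_ge0 (m - u); have := sqr_ge0 (m + v); have := sqr_ge0 (u + v); nra.
Qed.

End superprocess_waves.

(** The [M ^ n] diagonal pairs contribute the squared total mass [fourier_power nu 0] after
    normalisation. *)
Lemma mean_power_le (R : realType) (n : nat) (nu : MF R n)
    (s : {ffun 'I_n -> int} -> R) (M : nat) : (0 < M)%N ->
  (forall k, k != 0 -> fourier_power nu k <= (sqnorm k ^+ 2)^-1 * s k) ->
  mean_power nu M <= fourier_power nu 0 + lattice_average s M.
Proof.
move=> M0 nus; have Mn : 0 < M%:R ^+ n :> R by rewrite exprn_gt0// ltr0n.
rewrite /mean_power /lattice_average -(ler_pM2l Mn) mulrDr !mulrA divff ?gt_eqF// !mul1r.
rewrite -natrX -(@card_box n (24 * M) M); last by lia.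
rewrite mulr_natl -sumr_const -big_split; apply: ler_sum => J BJ.
rewrite (bigD1 J)//= subrr lerD2l; apply: ler_sum => J' /andP[_ J'J].
apply: nus; apply: contra J'J; rewrite subr_eq0 => /eqP/ffunP e.
by apply/eqP/ffunP => i; apply/val_inj; have := e i; rewrite !ffunE => -[].
Qed.

(** * Localisation by the size of the bracket *)

Section occupation_density.
Context {R : realType} {n : nat} {d : measure_display} {Omega : measurableType d}.
Variables (P : probability Omega R) (F : R -> set (set Omega))
  (g : 'rV[R]_n -> 'rV[R]_n -> R) (X : R -> Omega -> MF R n).
Hypothesis sX : superprocess g P F X.

(* The total mass is, up to a constant, the martingale of the function 1. *)
Lemma ae_mass_bounded : {ae P, forall w, forall T : R, 0 <= T ->
  exists2 K : R, 0 <= K & forall s : R, 0 <= s <= T -> (X s w setT <= K%:E)%E}.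
Proof.
have [_] := superprocess_martingale sX (Cb2_wave 1 0 0).
apply: filterS => w cM T T0.
have massE t : mp_martingale X (wave 1 0 0) t w =
    fine (X t w setT) - fine (X 0 w setT).
  rewrite /mp_martingale.
  have -> : \int[lebesgue_measure]_(s in `[0, t])
      pairing (X s w) (fun x => laplacian (wave 1 0 0) x / 2) = 0.
    rewrite (@eq_Rintegral _ _ _ _ _ (cst 0)); last first.
      move=> s _; rewrite -[RHS](mul0r (fine (X s w setT))) -pairing_cst.
      congr pairing; apply/funext => x.
      by rewrite laplacian_wave sqnorm0 mulr0 oppr0 mul0r mul0r.
    by rewrite Rintegral_cst ?mul0r//; exact: measurable_itv.
  by rewrite subr0 wave0 !pairing_cst !mul1r.
have cM' : {within `[0, T], continuous (fun t => mp_martingale X (wave 1 0 0) t w)}.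
  apply: continuous_subspaceW cM => t /=; rewrite !in_itv/= andbT.
  by move=> /andP[].
have [c _ hc] := EVT_max T0 cM'.
exists (fine (X c w setT)); first exact: fine_ge0.
move=> s sT; have := hc s; rewrite in_itv/= !massE => /(_ sT).
rewrite lerD2r -[X in (X <= _)%E]fineK ?fin_num_measure//.
Qed.

(** Its mean is at most [2 * K + 1] for every test function, whereas on a path whose brackets stay
    below [K] the truncation has no effect. *)
Definition truncated_square (phi : 'rV[R]_n -> R) (T K : R) (w : Omega) : R :=
  mp_martingale X phi T w ^+ 2 * \1_[set w | mp_bracket g X phi T w <= K] w.

Lemma truncated_square_ge0 phi T K w : 0 <= truncated_square phi T K w.
Proof. by rewrite mulr_ge0 ?sqr_ge0// indicE. Qed.

Lemma measurable_truncated_square phi T K : Cb2 phi -> 0 <= T ->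
  measurable_fun setT (truncated_square phi T K).
Proof.
move=> phi2 T0; have cF := superprocess_filtration sX.
have [[aM _ _] _] := superprocess_martingale sX phi2.
have [aA _ _ _] := superprocess_bracket sX phi2.
apply: measurable_funM.
  by apply: measurable_funX; exact: (adapted_measurable_fun cF aM).
apply: measurable_indic.
have -> : [set w | mp_bracket g X phi T w <= K] = mp_bracket g X phi T @^-1` `]-oo, K].
  by apply/seteqP; split => w /=; rewrite in_itv.
by rewrite -[_ @^-1` _]setTI; exact: (adapted_measurable_fun cF aA).
Qed.

Lemma integral_truncated_square_le phi T K : Cb2 phi -> 0 <= T -> 0 <= K ->
  (\int[P]_w (truncated_square phi T K w)%:E <= (2 * K + 1)%:E)%E.
Proof.
move=> phi2 T0 K0.
have [[aM _ _] _] := superprocess_martingale sX phi2.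
have := quadratic_variation_sublevel (superprocess_filtration sX) aM
  (fun w => mp_martingale0 X phi w) (superprocess_bracket sX phi2) T0 K0.
rewrite integral_mkcond; apply: le_trans; rewrite le_eqVlt; apply/orP; left.
apply/eqP; apply: eq_integral => w _; rewrite patchE /truncated_square indicE.
by case: ifP => _; rewrite ?mulr1 ?mulr0.
Qed.

Lemma ae_truncated_square_frequently (T K : R) : (n <= 3)%N -> 0 <= T -> 0 <= K ->
  {ae P, forall w, exists c : R, forall N, exists2 M, (N < M)%N &
    lattice_average (fun k => truncated_square (wave 1 k 0) T K w +
      truncated_square (wave (-1) k (pi / 2)) T K w) M <= c}.
Proof.
move=> n3 T0 K0.
apply: (@ae_lattice_average_frequently _ _ _ _ _
  (fun k w => truncated_square (wave 1 k 0) T K w +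
      truncated_square (wave (-1) k (pi / 2)) T K w) (2 * (2 * K + 1))) => //.
- by rewrite mulr_ge0// addr_ge0// mulr_ge0.
- by move=> k; apply: measurable_funD; apply: measurable_truncated_square => //; exact: Cb2_wave.
- by move=> k w; rewrite addr_ge0// truncated_square_ge0.
- move=> k _; under eq_integral do rewrite EFinD.
  rewrite ge0_integralD//; last 4 first.
  + by move=> w _; rewrite lee_fin truncated_square_ge0.
  + by apply/measurable_EFinP/measurable_truncated_square => //; exact: Cb2_wave.
  + by move=> w _; rewrite lee_fin truncated_square_ge0.
  + by apply/measurable_EFinP/measurable_truncated_square => //; exact: Cb2_wave.
  rewrite mulr_natl mulr2n EFinD; apply: leeD; apply: integral_truncated_square_le => //;
  exact: Cb2_wave.
Qed.

End occupation_density.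

(** * Conclusion: a single null set for all times *)

Lemma cos_phase_wave (R : realType) (n : nat) (k : {ffun 'I_n -> int}) :
  (fun x => cos (phase k x)) = wave 1 k 0 :> ('rV[R]_n -> R).
Proof. by apply/funext => x; rewrite /wave mul1r addr0. Qed.

Lemma sin_phase_wave (R : realType) (n : nat) (k : {ffun 'I_n -> int}) :
  (fun x => sin (phase k x)) = wave (-1) k (pi / 2) :> ('rV[R]_n -> R).
Proof. by apply/funext => x; rewrite /wave cosDpihalf mulN1r opprK. Qed.

Theorem corollary3p4 (R : realType) (n : nat) (d : measure_display)
    (Omega : measurableType d) (P : probability Omega R)
    (F : R -> set (set Omega)) (g : 'rV[R]_n -> 'rV[R]_n -> R)
    (mu : MF R n) (X : R -> Omega -> MF R n) :
  (1 <= n <= 3)%N ->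
  bounded_covariance g ->
  superprocess g P F X ->
  starts_at P X mu ->
  (n = 2%N \/ n = 3%N -> continuous_finite (green_potential mu)) ->
  {ae P, forall w, forall t : R, 0 <= t ->
    occupation X t w `<< @lebesgue_rV R n}.
Proof.
move=> /andP[_ n3] [_ [C0 gC0] _] sX _ _.
pose C := `|C0|.
have gC x y : `|g x y| <= C by apply: le_trans (gC0 x y) (ler_norm _).
(* Integer horizons and levels: a countable union of null sets, fixed before [T] and [K] are chosen
   in terms of the path. *)
have freq : {ae P, forall w, forall T K : nat, exists c : R,
    forall N, exists2 M, (N < M)%N &
    lattice_average (fun k => truncated_square g X (wave 1 k 0) T%:R K%:R w +
      truncated_square g X (wave (-1) k (pi / 2)) T%:R K%:R w) M <= c}.
  apply: ae_foralln => T; apply: ae_foralln => K.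
  exact: (ae_truncated_square_frequently sX n3).
apply: filterS3 freq (ae_mass_bounded sX) (superprocess_path_measurable sX).
move=> w freq mass mX t t0.
pose Tn := (Num.truncn t).+1; pose T : R := Tn%:R.
have T0 : 0 <= T by [].
have tT : t <= T by apply/ltW/truncnS_gt.
have [m m0 hm] := mass _ T0.
(* A level above the brackets of all waves on this path, which depends on [w] through the mass bound
   [m]. *)
pose Kn := (Num.truncn (m * T + C * m * m * T)).+1.
have AK phi : (forall x, `|phi x| <= 1) -> mp_bracket g X phi T w <= Kn%:R.
  move=> phi1; apply: le_trans (mp_bracket_le T0 m0 (normr_ge0 _) gC phi1 hm) _.
  exact/ltW/truncnS_gt.
have [Z [ZE Zpair]] := exists_time_average mX hm.
(* [Z] is [Y_T] with [T >= t], and [Y_t <= Y_T]. *)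
suff Zac : Z `<< @lebesgue_rV R n.
  move=> A /Zac ZA B mB BA; apply/eqP; rewrite eq_le; apply/andP; split; last first.
    exact: integral_ge0.
  rewrite -(ZA B mB BA) ZE /occupation integral_mkcond [leRHS]integral_mkcond.
  apply: ge0_subset_integral_le => s; rewrite !patchE !mem_setE !in_itv/=.
    by case: ifP.
  case: ifP => [/andP[s0 st]|_]; first by rewrite s0 (le_trans st).
  by case: ifP => _; [exact: measure_ge0|exact: lexx].
have [c hc] := freq Tn Kn.
(* The cosine and the sine each leave [6 * m ^+ 2] from the boundary terms, and 256 bounds the
   average of the constant 1. *)
apply: (@mean_power_null_dominates _ _ Z
  (fourier_power Z 0 + (3 * c + 12 * m ^+ 2 * 256)) n3) => N.
have [M NM cM] := hc N; exists M => //.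
have M0 : (0 < M)%N by exact: leq_ltn_trans NM.
have wave_le (e a : R) k : k != 0 -> `|e| <= 1 -> pairing Z (wave e k a) ^+ 2 <=
    (sqnorm k ^+ 2)^-1 *
    (3 * truncated_square g X (wave e k a) T Kn%:R w + 6 * m ^+ 2).
  move=> k0 e1; have [iX Ze] := Zpair _ (Cb_wave e k a).
  (* By [AK], the truncation is inactive on this path. *)
  rewrite /truncated_square indicE mem_set ?mulr1; last first.
    apply: AK => x; rewrite normrM -[leRHS]mulr1 ler_pM//; exact: cos_max.
  by apply: sqr_pairing_wave_le => //; apply: hm; rewrite lexx T0.
pose S k := truncated_square g X (wave 1 k 0) T Kn%:R w +
  truncated_square g X (wave (-1) k (pi / 2)) T Kn%:R w.
have power_le k : k != 0 -> fourier_power Z k <=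
    (sqnorm k ^+ 2)^-1 * (3 * S k + 12 * m ^+ 2 * 1).
  move=> k0; rewrite /fourier_power cos_phase_wave sin_phase_wave.
  have := wave_le 1 0 k k0; have := wave_le (-1) (pi / 2) k k0.
  rewrite normrN normr1 => /(_ (lexx 1)) h1 /(_ (lexx 1)) h2.
  apply: le_trans (lerD h2 h1) _; rewrite -mulrDr /S.
  set a := truncated_square _ _ _ _ _ _; set b := truncated_square _ _ _ _ _ _.
  by rewrite le_eqVlt; apply/orP; left; apply/eqP; congr (_ * _); ring.
apply: le_trans (mean_power_le M0 power_le) _.
rewrite lerD2l (lattice_averageD (fun k => 3 * S k)) !lattice_averageZ.
apply: lerD; first by rewrite ler_pM2l.
by rewrite ler_wpM2l ?mulr_ge0 ?sqr_ge0//; exact: lattice_average1_le.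
Qed.
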